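(* Let $\alpha>-1$ and let $n\ge1$ be an integer. For $(x,y)\in\mathrm T$ let $$Y(x,y)=\begin{cases}y^\alpha(1-y),& x\le1,\\ y^\alpha,& x>1,\end{cases}\qquad \widetilde\Phi_y(x,y)=\min\left\{\sqrt{y(1-y)},\ \frac{\sqrt y\,\sqrt{2-x-y}}{\sqrt{2-x}}\right\}.$$ Let $\triangle=\{(x,y)\in\mathbb R^2:0\le y\le1,\ 1\le x\le2-y\}$. Then, for each $f\in\Pi_n$, $$\|Hf\|_{L^2(\triangle,Y)}^2+\|\widetilde\Phi_y\,\partial_yf\|_{L^2(\mathrm T,Y)}^2\le n(n+\alpha+2)\,\|f\|_{L^2(\mathrm T,Y)}^2,$$ where $$Hf(x,y)=\frac{\sqrt{x-1}}{\sqrt{2-x}}\bigl((x-2)\,\partial_xf(x,y)+y\,\partial_yf(x,y)\bigr).$$ Equality is attained for $f(x,y)=\mathsf P_n^{(\alpha,1)}(y)$.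
   Context: $\Pi_n$ is the space of real algebraic polynomials in two variables of total degree at most $n$. The trapezoid is $\mathrm T=\{(x,y)\in\mathbb R^2:0\le y\le 1,\ 0\le x\le 2-y\}$. For a measurable set $E$ and weight $Y$, $\|u\|_{L^2(E,Y)}^2=\int_E|u|^2\,Y\,dx\,dy$. (The expressions with denominator $\sqrt{2-x}$ are undefined only at the single point $(2,0)$, which has measure zero.) $P_n^{(a,b)}$ denotes the classical Jacobi polynomial of degree $n$, orthogonal on $[-1,1]$ with respect to $(1-u)^a(1+u)^b$, and $\mathsf P_n^{(a,b)}(u)=P_n^{(a,b)}(1-2u)$ is its shifted version on $[0,1]$. *)

(* Defs.v *)
From HB Require Import structures.
From mathcomp Require Import all_boot all_order all_algebra.
From mathcomp Require Import all_classical all_reals all_analysis.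
(* The notations of mpoly clash with those of analysis. *)
From mathcomp Require mpoly.
Import (coercions, canonicals) mpoly.

Set Implicit Arguments.
Unset Strict Implicit.
Unset Printing Implicit Defensive.

Import Order.TTheory GRing.Theory Num.Theory.
Import numFieldNormedType.Exports.

Local Open Scope classical_set_scope.
Local Open Scope ring_scope.

(* Real polynomials in two variables; variable 0 is x and variable 1 is y. *)
Definition bipoly (R : realType) := mpoly.mpoly 2 R.

Definition ix : 'I_2 := ord0.
Definition iy : 'I_2 := ord_max.

(* msize is the total degree plus one, and 0 for the zero polynomial. *)
Definition in_Pi (R : realType) (n : nat) (f : bipoly R) : Prop :=
  (mpoly.msize f <= n.+1)%N.

Definition bieval (R : realType) (f : bipoly R) (z : R * R) : R :=
  mpoly.meval (fun i => if i == ix then z.1 else z.2) f.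

Definition dx (R : realType) (f : bipoly R) : bipoly R := mpoly.mderiv ix f.
Definition dy (R : realType) (f : bipoly R) : bipoly R := mpoly.mderiv iy f.

Definition trapezoid (R : realType) : set (R * R) :=
  [set z | 0 <= z.2 <= 1 /\ 0 <= z.1 <= 2 - z.2].

Definition triangle (R : realType) : set (R * R) :=
  [set z | 0 <= z.2 <= 1 /\ 1 <= z.1 <= 2 - z.2].

Definition sqnormL2 (R : realType) (E : set (R * R)) (w u : R * R -> R) :
    \bar R :=
  (\int[lebesgue_measure \x lebesgue_measure]_(z in E)
     (`|u z| ^+ 2 * w z)%:E)%E.

Definition weightY (R : realType) (a : R) (z : R * R) : R :=
  if z.1 <= 1 then z.2 `^ a * (1 - z.2) else z.2 `^ a.

(* In Phi_y and Hop the division by sqrt (2 - x) is by zero on the trapezoid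
   only at (2, 0), a null set. *)
Definition Phi_y (R : realType) (z : R * R) : R :=
  Num.min (Num.sqrt (z.2 * (1 - z.2)))
          (Num.sqrt z.2 * Num.sqrt (2 - z.1 - z.2) / Num.sqrt (2 - z.1)).

Definition Hop (R : realType) (f : bipoly R) (z : R * R) : R :=
  Num.sqrt (z.1 - 1) / Num.sqrt (2 - z.1) *
  ((z.1 - 2) * bieval (dx f) z + z.2 * bieval (dy f) z).

(* P is the classical Jacobi polynomial P_n^(a,b) (for a, b > -1): degree n,
   orthogonal on [-1, 1] to all polynomials of smaller degree for the weight
   (1-u)^a (1+u)^b, with the usual normalization P(1) = binom(n+a, n); these
   conditions determine P. *)
Definition is_jacobi (R : realType) (a b : R) (n : nat) (P : {poly R}) : Prop :=
  [/\ size P = n.+1,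
      P.[1] = \prod_(i < n) ((a + i.+1%:R) / i.+1%:R) &
      forall Q : {poly R}, (size Q <= n)%N ->
        (\int[lebesgue_measure]_(u in `[(-1)%R, 1%R])
           (P.[u] * Q.[u] * ((1 - u) `^ a * (1 + u) `^ b))%:E = 0)%E].

Definition shifted (R : realType) (P : {poly R}) : {poly R} :=
  P \Po (1 - 2 *: 'X).

(* The univariate p seen as the bivariate polynomial p(y). *)
Definition in_y (R : realType) (p : {poly R}) : bipoly R :=
  horner_alg (mpoly.mpolyX R (mpoly.mnm1 iy) : mpoly.mpoly 2 R) p.

(* Main.v *)
(** Left of [x = 1] the claim is, for each fixed [x], the spectral bound for the
    Jacobi operator in [y] with weight [y^a (1 - y)].  Right of [x = 1], put
    [s = 2 - x]: the singular factors [1 / s] of the two terms on the left cancel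
    and their sum is [y^a] times the Dirichlet form of the Jacobi operator of the
    simplex [0 <= y <= s <= 1], which is triangular with eigenvalue [k (k + a + 2)]
    on total degree [k].  Both operators are symmetric, so that a polynomial of
    degree [n] is a sum of orthogonal eigenvectors whose eigenvalues are at most
    [n (n + a + 2)].  Symmetry only involves moments, hence is an identity of
    rational functions.  For the equality case, integrating a polynomial in [y]
    over [s] turns the weight [y^a] into [y^a (1 - y)], so that both halves reduce
    to the same one-dimensional eigenvalue equation. *)

Require Import Defs.
From HB Require Import structures.
From mathcomp Require Import all_boot all_order all_algebra.
From mathcomp Require Import all_classical all_reals all_analysis.
From mathcomp Require Import measurable_realfun.
From mathcomp Require mpoly ssrcomplements.
From mathcomp Require Import ring lra.
Import (coercions, canonicals) mpoly.
Set Implicit Arguments.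
Unset Strict Implicit.
Unset Printing Implicit Defensive.
Import Order.TTheory GRing.Theory Num.Theory.
Import numFieldNormedType.Exports.
Local Open Scope classical_set_scope.
Local Open Scope ring_scope.

(** * Spectral bound *)

(** Neither operator is diagonalized explicitly: a triangular operator with strictly increasing
    diagonal already has enough eigenvectors, and symmetry makes them orthogonal. Both inner
    products are therefore defined algebraically, through linear functionals given by their moments.
    Checking symmetry on moments avoids integrating by parts against y^a, which is unbounded at 0
    when a < 0. Integration serves to identify these functionals with actual integrals, which yields
    their positivity on squares and expresses the norms. The bound for fixed x is carried out on the
    whole unit square, with x a mere parameter of the operator. On the right, the square of [Hop f]
    contains 1 / s and is not known to be integrable beforehand; only its sum with the [Phi_y] term
    is y^a times a polynomial. The two nonnegative integrals are therefore added as extended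
    reals. *)

Section Spectral.
Variables (R : realFieldType) (V : lmodType R) (L : {linear V -> V}).
Variable lam : nat -> R.

(** Each [v k] is the whole component for [lam k], possibly zero, so that eigenspaces of any
    dimension are covered without choosing a basis. *)
Definition eigensum (n : nat) (f : V) : Prop :=
  exists2 v : nat -> V, f = \sum_(k < n.+1) v k &
    forall k, (k <= n)%N -> L (v k) = lam k *: v k.

Lemma eigensumD n f g : eigensum n f -> eigensum n g -> eigensum n (f + g).
Proof.
move=> [u -> Lu] [v -> Lv]; exists (fun k => u k + v k).
  by rewrite big_split.
by move=> k kn; rewrite linearD Lu// Lv// scalerDr.
Qed.

Lemma eigensumZ n c f : eigensum n f -> eigensum n (c *: f).
Proof.
move=> [u -> Lu]; exists (fun k => c *: u k); first by rewrite scaler_sumr.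
by move=> k kn; rewrite linearZ/= Lu// !scalerA mulrC.
Qed.

Lemma eigensum0 n : eigensum n 0.
Proof. by exists (fun=> 0); [rewrite big1|move=> k _; rewrite linear0 scaler0]. Qed.

Lemma eigensum_sum n (I : eqType) (r : seq I) (F : I -> V) :
  {in r, forall i, eigensum n (F i)} -> eigensum n (\sum_(i <- r) F i).
Proof.
elim: r => [|i r IH] H; first by rewrite big_nil; exact: eigensum0.
rewrite big_cons; apply: eigensumD; first by apply: H; rewrite mem_head.
by apply: IH => k kr; apply: H; rewrite in_cons kr orbT.
Qed.

Lemma eigensumS n f : eigensum n f -> eigensum n.+1 f.
Proof.
move=> [u -> Lu]; exists (fun k => if (k <= n)%N then u k else 0).
  rewrite [RHS]big_ord_recr/= ltnn addr0.
  by apply: eq_bigr => k _; rewrite -ltnS ltn_ord.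
by move=> k _; case: ifP => [/Lu//|_]; rewrite linear0 scaler0.
Qed.

Lemma eigensumW n m f : (n <= m)%N -> eigensum n f -> eigensum m f.
Proof.
move=> /subnKC <-; elim: (m - n)%N => [|k IH]; first by rewrite addn0.
by rewrite addnS => /IH; exact: eigensumS.
Qed.

Hypothesis lam_lt : forall k n, (k < n)%N -> lam k < lam n.

(* Dividing by the gaps [lam k - lam n.+1] corrects [f] to an eigenvector. *)
Lemma eigensum_step n f :
  eigensum n (L f - lam n.+1 *: f) -> eigensum n.+1 f.
Proof.
move=> [u Lf Lu].
pose h := \sum_(k < n.+1) (lam k - lam n.+1)^-1 *: u k.
have Lh : L h - lam n.+1 *: h = L f - lam n.+1 *: f.
  rewrite Lf /h linear_sum scaler_sumr -sumrB; apply: eq_bigr => k _.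
  rewrite linearZ/= Lu -1?ltnS// !scalerA [lam n.+1 * _]mulrC -scalerBl -mulrBr.
  rewrite mulVf ?scale1r//.
  by rewrite subr_eq0 lt_eqF// lam_lt.
have -> : f = (f - h) + h by rewrite subrK.
apply: eigensumD.
  exists (fun k => if k == n.+1 then f - h else 0).
    rewrite big_ord_recr/= eqxx big1 ?add0r// => k _.
    by rewrite ltn_eqF.
  move=> k _; case: eqP => [->|_]; last by rewrite linear0 scaler0.
  rewrite linearB scalerBr; move/eqP: Lh; rewrite eq_sym subr_eq => /eqP ->.
  by rewrite addrC -!addrA addKr addrC.
apply: eigensumS; exists (fun k => (lam k - lam n.+1)^-1 *: u k) => //.
by move=> k kn; rewrite linearZ/= Lu// !scalerA mulrC.
Qed.

Variable ip : V -> V -> R.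
Hypothesis ip_linear : forall c u v w, ip (c *: u + v) w = c * ip u w + ip v w.
Hypothesis ipC : forall u v, ip u v = ip v u.
Hypothesis ip_ge0 : forall u, 0 <= ip u u.
Hypothesis ipL : forall u v, ip (L u) v = ip u (L v).

(** By symmetry, components with distinct eigenvalues are orthogonal. Both sides are then diagonal
    sums, compared term by term since [lam k <= lam n]. *)
Lemma rayleigh_le n f : eigensum n f -> ip (L f) f <= lam n * ip f f.
Proof.
have ip0 w : ip 0 w = 0.
  have := ip_linear (-1) 0 0 w.
  by rewrite scaler0 addr0 mulN1r addNr.
have ipZ c u w : ip (c *: u) w = c * ip u w.
  by rewrite -[c *: u]addr0 ip_linear ip0 addr0.
have ipS (r : seq 'I_n.+1) (F : 'I_n.+1 -> V) w :
    ip (\sum_(k <- r) F k) w = \sum_(k <- r) ip (F k) w.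
  elim: r => [|k r IH]; first by rewrite !big_nil ip0.
  by rewrite !big_cons -IH -[F k]scale1r ip_linear mul1r scale1r.
move=> [v fE Lv].
have orth k l : (k <= n)%N -> (l <= n)%N -> k != l -> ip (v k) (v l) = 0.
  move=> kn ln kl; have := ipL (v k) (v l).
  rewrite Lv// Lv// [in RHS]ipC !ipZ [ip (v l) _]ipC => /eqP.
  rewrite -subr_eq0 -mulrBl mulf_eq0 => /orP[|/eqP//].
  rewrite subr_eq0; move: kl; rewrite neq_ltn => /orP[] /lam_lt kl.
    by rewrite lt_eqF.
  by rewrite gt_eqF.
(* Used with [c = lam] for [L f] and with [c = 1] for [f] itself. *)
have diag w (c : nat -> R) (k : 'I_n.+1) :
    w = f -> ip (c k *: v k) w = c k * ip (v k) (v k).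
  move=> ->; rewrite ipZ ipC fE ipS (bigD1 k)//= big1 ?addr0// => l lk.
  by apply: orth => //; rewrite -ltnS.
have Lf : L f = \sum_(k < n.+1) lam k *: v k.
  rewrite fE linear_sum; apply: eq_bigr => k _.
  by rewrite Lv// -ltnS.
rewrite Lf ipS.
under eq_bigr do rewrite (diag f lam)//.
have -> : ip f f = \sum_(k < n.+1) ip (v k) (v k).
  rewrite {1}fE ipS; apply: eq_bigr => k _.
  by rewrite -[v k]scale1r (diag f (fun=> 1))// scale1r mul1r.
rewrite mulr_sumr; apply: ler_sum => k _.
rewrite ler_wpM2r ?ip_ge0//.
have : (k <= n)%N by rewrite -ltnS.
by rewrite leq_eqVlt => /predU1P[->//|/lam_lt/ltW].
Qed.

End Spectral.

(** * Monomials and linear extension *)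

Section Monomials.
Variable R : realType.
Local Notation V := (bipoly R).

Definition varx : V := mpoly.mpolyX R (mpoly.mnm1 ix).
Definition vary : V := mpoly.mpolyX R (mpoly.mnm1 iy).
Definition monomial (i j : nat) : V := varx ^+ i * vary ^+ j.

Lemma monM i j k l : monomial i j * monomial k l = monomial (i + k) (j + l).
Proof. by rewrite /monomial !exprD; ring. Qed.

Lemma mpolyX_mon (m : mpoly.multinom 2) :
  mpoly.mpolyX R m = monomial (m ix) (m iy).
Proof.
rewrite mpoly.mpolyXE_id big_ord_recl big_ord1 /monomial.
by rewrite (_ : lift ord0 ord0 = iy)//; apply/val_inj.
Qed.

Lemma bipolyE (f : V) :
  f = \sum_(m <- mpoly.msupp f) mpoly.mcoeff m f *: monomial (m ix) (m iy).
Proof.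
by rewrite {1}(mpoly.mpolyE f); apply: eq_bigr => m _; rewrite mpolyX_mon.
Qed.

Section LinearExtension.
Variables (W : lmodType R) (phi : nat -> nat -> W).

Definition linext (p : V) : W :=
  \sum_(m <- mpoly.msupp p) mpoly.mcoeff m p *: phi (m ix) (m iy).

(** The support varies with the polynomial; an index set depending only on a degree bound makes
    linearity a termwise computation. *)
Lemma linextE p k : (mpoly.msize p <= k)%N ->
  linext p = \sum_(m : mpoly.bmultinom 2 k)
    mpoly.mcoeff (mpoly.bmnm m) p *: phi (mpoly.bmnm m ix) (mpoly.bmnm m iy).
Proof.
move=> le_pk; set I : subFinType _ := mpoly.bmultinom 2 k.
rewrite /linext (ssrcomplements.big_mksub I) ?mpoly.msupp_uniq //=; first last.
  by move=> x /mpoly.msize_mdeg_lt /leq_trans; apply.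
rewrite big_rmcond //= => j /mpoly.memN_msupp_eq0 ->.
by rewrite scale0r.
Qed.

Lemma linext_is_linear : linear linext.
Proof.
move=> c p q.
pose k := maxn (mpoly.msize (c *: p + q)) (maxn (mpoly.msize p) (mpoly.msize q)).
rewrite !(@linextE _ k) ?leq_max ?leqnn ?orbT//.
rewrite scaler_sumr -big_split/=; apply: eq_bigr => m _.
by rewrite mpoly.mcoeffD mpoly.mcoeffZ scalerDl scalerA.
Qed.

HB.instance Definition _ := GRing.isLinear.Build R V W _ linext linext_is_linear.

Lemma linext_mon i j : linext (monomial i j) = phi i j.
Proof.
rewrite /monomial !mpoly.mpolyXn -mpoly.mpolyXD /linext mpoly.msuppX big_seq1.
rewrite mpoly.mcoeffX eqxx scale1r.
by rewrite !mpoly.mnmDE !mpoly.mulmnE !mpoly.mnm1E/= !mul1n !mul0n addn0.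
Qed.

End LinearExtension.

Lemma dx_mon i j : dx (monomial i j) = i%:R *: monomial i.-1 j.
Proof.
rewrite /dx.
have -> : monomial i j = mpoly.mpolyX R (mpoly.mnm_add
  (mpoly.mnm_muln (mpoly.mnm1 ix) i) (mpoly.mnm_muln (mpoly.mnm1 iy) j)).
  by rewrite mpoly.mpolyXD /monomial !mpoly.mpolyXn.
rewrite mpoly.mderivX mpolyX_mon.
rewrite !mpoly.mnmBE !mpoly.mnmDE !mpoly.mulmnE !mpoly.mnm1E/=.
by rewrite !mul1n !mul0n addn0 subn0 subn1.
Qed.

Lemma dy_mon i j : dy (monomial i j) = j%:R *: monomial i j.-1.
Proof.
rewrite /dy.
have -> : monomial i j = mpoly.mpolyX R (mpoly.mnm_add
  (mpoly.mnm_muln (mpoly.mnm1 ix) i) (mpoly.mnm_muln (mpoly.mnm1 iy) j)).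
  by rewrite mpoly.mpolyXD /monomial !mpoly.mpolyXn.
rewrite mpoly.mderivX mpolyX_mon.
rewrite !mpoly.mnmBE !mpoly.mnmDE !mpoly.mulmnE !mpoly.mnm1E/=.
by rewrite !mul1n !mul0n addn0 subn0 subn1.
Qed.

Lemma bievalD (f g : V) z : bieval (f + g) z = bieval f z + bieval g z.
Proof. exact: mpoly.mevalD. Qed.

Lemma bievalM (f g : V) z : bieval (f * g) z = bieval f z * bieval g z.
Proof. exact: mpoly.mevalM. Qed.

Lemma bievalZ c (f : V) z : bieval (c *: f) z = c * bieval f z.
Proof. exact: mpoly.mevalZ. Qed.

Lemma bieval_mon i j z : bieval (monomial i j) z = z.1 ^+ i * z.2 ^+ j.
Proof. by rewrite bievalM /bieval !rmorphXn/= !mpoly.mevalXU. Qed.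

End Monomials.

(** * The two Jacobi operators *)

Section Operators.
Variables (R : realType) (a : R).
Hypothesis ha : -1 < a.
Local Notation V := (bipoly R).
Local Notation mon := (monomial R).
Local Notation varx := (varx R).
Local Notation vary := (vary R).

(** Jacobi parameters (a, b) give the eigenvalue k (k + a + b + 1), here with b = 1; the simplex
    weight y^a (s - y)^b (1 - s)^c gives k (k + a + b + c + 2), here with b = c = 0. The two
    sequences coincide. *)
Definition lam (k : nat) : R := k%:R * (k%:R + a + 2).

Lemma lam_lt k n : (k < n)%N -> lam k < lam n.
Proof.
move=> kn; have k0 : 0 <= k%:R :> R by [].
have : k%:R + 1 <= n%:R :> R by rewrite natr1 ler_nat.
move=> kn1; rewrite -subr_gt0.
have -> : lam n - lam k = (n%:R - k%:R) * (n%:R + k%:R + a + 2).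
  by rewrite /lam; ring.
by have := ha; move=> ha1; apply: mulr_gt0; lra.
Qed.

(* The integral of [x^i y^j] over the unit square for the weight [y^a (1 - y)],
   and of [s^i y^j] over [0 <= y <= s <= 1] for the weight [y^a]. *)
Definition rect_moment (i j : nat) : R :=
  ((i%:R + 1) * ((j%:R + a + 1) * (j%:R + a + 2)))^-1.
Definition tri_moment (i j : nat) : R :=
  ((j%:R + a + 1) * (i%:R + j%:R + a + 2))^-1.

Definition rect_functional : {linear V -> R^o} := linext (W := R^o) rect_moment.
Definition tri_functional : {linear V -> R^o} := linext (W := R^o) tri_moment.

(* [L f = - w^-1 (w y (1 - y) f_y)_y] with [w = y^a (1 - y)], and the simplex
   operator [- y^-a ((y^a (1 - s) (s f_s + y f_y))_s
   + (y^a ((1 - s) y f_s + y (1 - y) f_y))_y], on monomials.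
   The truncated [i.-1] and [j.-1] come with a coefficient vanishing at 0. *)
Definition rect_op_mon (i j : nat) : V :=
  lam j *: mon i j - (j%:R * (j%:R + a)) *: mon i j.-1.
Definition tri_op_mon (i j : nat) : V :=
  lam (i + j) *: mon i j - (i%:R * (i%:R + 2 * j%:R + a + 1)) *: mon i.-1 j
  - (j%:R * (j%:R + a)) *: mon i j.-1.

Definition rect_op : {linear V -> V} := linext rect_op_mon.
Definition tri_op : {linear V -> V} := linext tri_op_mon.

Definition rect_form (f g : V) : V := vary * (1 - vary) * dy f * dy g.

(* [tri_form f f], with [varx] standing for [s], is the sum of the squares of
   [Phi_y f_y] and [Hop f]: the terms in [y^2 f_y^2 / s] cancel. *)
Definition tri_form (f g : V) : V :=
  (1 - varx) * (varx * dx f * dx g + vary * (dx f * dy g + dy f * dx g))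
  + vary * (1 - vary) * dy f * dy g.

Lemma varxE : varx = mon 1 0.
Proof. by rewrite /monomial expr1 mulr1. Qed.

Lemma varyE : vary = mon 0 1.
Proof. by rewrite /monomial expr1 mul1r. Qed.

(** The factor in front restores one of the two powers lost to the derivatives, so a single
    truncated exponent remains; if [i] or [k] is 0, both sides vanish. *)
Lemma xdxdx_mon i j k l : varx * dx (mon i j) * dx (mon k l) =
  (i%:R * k%:R) *: mon (i + k).-1 (j + l).
Proof.
rewrite !dx_mon varxE; case: i => [|i].
  by rewrite scale0r mulr0 !mul0r scale0r.
case: k => [|k]; first by rewrite !scale0r !mulr0 scale0r.
rewrite -!scalerAr -!scalerAl scalerA !monM mulrC; congr (_ *: mon _ _).
by rewrite addnS.
Qed.

Lemma ydxdy_mon i j k l : vary * dx (mon i j) * dy (mon k l) =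
  (i%:R * l%:R) *: mon (i + k).-1 (j + l).
Proof.
rewrite dx_mon dy_mon varyE; case: i => [|i].
  by rewrite scale0r mulr0 !mul0r scale0r.
case: l => [|l]; first by rewrite !scale0r !mulr0 scale0r.
rewrite -!scalerAr -!scalerAl scalerA !monM mulrC; congr (_ *: mon _ _).
by rewrite /= add1n addSnnS.
Qed.

Lemma ydydy_mon i j k l : vary * dy (mon i j) * dy (mon k l) =
  (j%:R * l%:R) *: mon (i + k) (j + l).-1.
Proof.
rewrite !dy_mon varyE; case: j => [|j].
  by rewrite scale0r mulr0 !mul0r scale0r.
case: l => [|l]; first by rewrite !scale0r !mulr0 scale0r.
rewrite -!scalerAr -!scalerAl scalerA !monM mulrC; congr (_ *: mon _ _).
by rewrite addnS.
Qed.

(** The exponent [(i + k).-1.+1] differs from [i + k] when the sum is 0, but the coefficient is then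
    0; written this way, the formula needs no side condition. *)
Lemma tri_form_mon i j k l : tri_form (mon i j) (mon k l) =
  (i%:R * k%:R + i%:R * l%:R + j%:R * k%:R) *:
    (mon (i + k).-1 (j + l) - mon (i + k).-1.+1 (j + l)) +
  (j%:R * l%:R) *: (mon (i + k) (j + l).-1 - mon (i + k) (j + l).-1.+1).
Proof.
rewrite /tri_form.
have -> : vary * (dx (mon i j) * dy (mon k l) + dy (mon i j) * dx (mon k l)) =
  vary * dx (mon i j) * dy (mon k l) + vary * dx (mon k l) * dy (mon i j) by ring.
have -> : vary * (1 - vary) * dy (mon i j) * dy (mon k l) =
  (1 - vary) * (vary * dy (mon i j) * dy (mon k l)) by ring.
rewrite xdxdx_mon !ydxdy_mon ydydy_mon (addnC k i) (addnC l j) -!scalerDl.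
rewrite -!scalerAr !mulrBl !mul1r varxE varyE !monM !add0n !add1n.
by congr (_ *: _ + _); ring.
Qed.

Lemma rect_form_mon i j k l : rect_form (mon i j) (mon k l) =
  (j%:R * l%:R) *: (mon (i + k) (j + l).-1 - mon (i + k) (j + l).-1.+1).
Proof.
rewrite /rect_form.
have -> : vary * (1 - vary) * dy (mon i j) * dy (mon k l) =
  (1 - vary) * (vary * dy (mon i j) * dy (mon k l)) by ring.
by rewrite ydydy_mon -!scalerAr !mulrBl !mul1r varyE !monM !add0n !add1n.
Qed.

(** This law and the next two restate linearity for values in [R^o] so that rewriting produces the
    operations of [R], ready for [ring] and [field]. *)
Lemma linextD (phi : nat -> nat -> R^o) f g :
  linext phi (f + g) = linext phi f + linext phi g.
Proof. exact: linearD. Qed.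

Lemma linextN (phi : nat -> nat -> R^o) f : linext phi (- f) = - linext phi f.
Proof. exact: linearN. Qed.

Lemma linextZ (phi : nat -> nat -> R^o) (c : R) f :
  linext phi (c *: f) = c * linext phi f.
Proof. exact: linearZ. Qed.

Lemma scale_monM c i j k l : (c *: mon i j) * mon k l = c *: mon (i + k) (j + l).
Proof. by rewrite -scalerAl monM. Qed.

(** The factor [i%:R] pays for replacing [i.-1 + k] by [(i + k).-1], which is wrong when
    [i = 0 < k]. *)
Lemma scale_mon_predlM c i j k l :
  (i%:R * c *: mon i.-1 j) * mon k l = (i%:R * c) *: mon (i + k).-1 (j + l).
Proof. by case: i => [|i]; rewrite ?mul0r ?scale0r ?mul0r ?scale_monM. Qed.

Lemma scale_mon_predrM c i j k l :
  (j%:R * c *: mon i j.-1) * mon k l = (j%:R * c) *: mon (i + k) (j + l).-1.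
Proof. by case: j => [|j]; rewrite ?mul0r ?scale0r ?mul0r ?scale_monM. Qed.

Lemma rect_form_sym_mon i j k l :
  rect_functional (rect_form (mon i j) (mon k l)) =
  rect_functional (rect_op (mon i j) * mon k l).
Proof.
rewrite rect_form_mon /rect_op/= linext_mon /rect_op_mon.
rewrite mulrBl scale_mon_predrM scale_monM.
rewrite /rect_functional/= !(linextD, linextN, linextZ, linext_mon) /rect_moment /lam.
have a1 := ha; case jl : (j + l)%N => [|m].
  move: jl => /eqP; rewrite addn_eq0 => /andP[/eqP-> /eqP->].
  by ring.
(* Trading [j] for [m = j + l - 1] removes the truncated predecessor; all denominators are positive
   because [a > -1] and [m >= 0]. *)
have jE : j%:R = m%:R + 1 - l%:R :> R by rewrite natr1 -jl natrD addrK.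
have m0 : 0 <= m%:R :> R by [].
have ik0 : 0 <= (i + k)%:R :> R by [].
rewrite /= jE -[m.+1%:R]natr1; set p := (i + k)%:R.
field.
by do ?(apply/andP; split); apply: lt0r_neq0; rewrite ?/p; lra.
Qed.

Lemma tri_form_sym_mon i j k l :
  tri_functional (tri_form (mon i j) (mon k l)) =
  tri_functional (tri_op (mon i j) * mon k l).
Proof.
rewrite tri_form_mon /tri_op/= linext_mon /tri_op_mon.
rewrite !mulrBl scale_mon_predrM scale_mon_predlM scale_monM.
rewrite /tri_functional/= !(linextD, linextN, linextZ, linext_mon).
rewrite /tri_moment /lam [(i + j)%:R]natrD.
have a1 := ha.
have m0 (m : nat) : 0 <= m%:R :> R by [].
(* Both [i + k] and [j + l] carry a truncated predecessor, whence four cases. A vanishing sum forces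
   both of its exponents to be 0; otherwise one exponent is eliminated. *)
case jl : (j + l)%N => [|m].
  move: jl => /eqP; rewrite addn_eq0 => /andP[/eqP-> /eqP->].
  case ik : (i + k)%N => [|p].
    move: ik => /eqP; rewrite addn_eq0 => /andP[/eqP-> /eqP->].
    by ring.
  have iE : i%:R = p%:R + 1 - k%:R :> R by rewrite natr1 -ik natrD addrK.
  have := m0 p; rewrite /= iE -[p.+1%:R]natr1 => p0.
  by field; do ?(apply/andP; split); apply: lt0r_neq0; lra.
have jE : j%:R = m%:R + 1 - l%:R :> R by rewrite natr1 -jl natrD addrK.
have := m0 m => m0'.
case ik : (i + k)%N => [|p].
  move: ik => /eqP; rewrite addn_eq0 => /andP[/eqP-> /eqP->].
  rewrite /= jE -[m.+1%:R]natr1.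
  by field; do ?(apply/andP; split); apply: lt0r_neq0; lra.
have iE : i%:R = p%:R + 1 - k%:R :> R by rewrite natr1 -ik natrD addrK.
have := m0 p; rewrite /= iE jE -[p.+1%:R]natr1 -[m.+1%:R]natr1 => p0.
by field; do ?(apply/andP; split); apply: lt0r_neq0; lra.
Qed.

End Operators.

(** * Symmetry and spectral bounds on polynomials of bounded degree *)

Section RayleighBounds.
Variables (R : realType) (a : R).
Local Notation V := (bipoly R).
Local Notation mon := (monomial R).
Local Notation varx := (varx R).
Local Notation vary := (vary R).
Local Notation lam := (lam a).

(** Linearity is a plain equation here because the forms compared are composites such as
    [linext phi (form f g)] with one argument fixed, which carry no bundled linear structure. *)
Lemma linear_form_ext (F G : V -> R) :
  (forall c u v, F (c *: u + v) = c * F u + F v) ->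
  (forall c u v, G (c *: u + v) = c * G u + G v) ->
  (forall i j, F (mon i j) = G (mon i j)) -> F =1 G.
Proof.
move=> Fl Gl FG f.
have H0 (H : V -> R) : (forall c u v, H (c *: u + v) = c * H u + H v) -> H 0 = 0.
  by move=> /(_ (-1) 0 0); rewrite scaler0 addr0 mulN1r addNr.
rewrite (bipolyE f); elim: (mpoly.msupp f) => [|m s IH].
  by rewrite !big_nil (H0 F)// (H0 G).
by rewrite !big_cons Fl Gl IH FG.
Qed.

Lemma dx_lin c (u v : V) : dx (c *: u + v) = c *: dx u + dx v.
Proof. by rewrite /dx mpoly.mderivD mpoly.mderivZ. Qed.

Lemma dy_lin c (u v : V) : dy (c *: u + v) = c *: dy u + dy v.
Proof. by rewrite /dy mpoly.mderivD mpoly.mderivZ. Qed.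

(** Turns scaling into a product of [V], so that [ring] can prove linearity of the forms. *)
Lemma scale_mull (c : R) : exists t : V, forall u : V, c *: u = t * u.
Proof. by exists (c%:A) => u; rewrite mulr_algl. Qed.

Lemma rect_formC (f g : V) : rect_form f g = rect_form g f.
Proof. by rewrite /rect_form; ring. Qed.

Lemma tri_formC (f g : V) : tri_form f g = tri_form g f.
Proof. by rewrite /tri_form; ring. Qed.

Lemma rect_form_lin c (u v g : V) :
  rect_form (c *: u + v) g = c *: rect_form u g + rect_form v g.
Proof.
have [t tE] := scale_mull c.
by rewrite /rect_form !dy_lin !tE; ring.
Qed.

Lemma tri_form_lin c (u v g : V) :
  tri_form (c *: u + v) g = c *: tri_form u g + tri_form v g.
Proof.
have [t tE] := scale_mull c.
by rewrite /tri_form !dy_lin !dx_lin !tE; ring.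
Qed.

Lemma linext_lin (phi : nat -> nat -> R^o) c u v :
  linext phi (c *: u + v) = c * linext phi u + linext phi v.
Proof. by rewrite linextD linextZ. Qed.

(** Both sides are bilinear, so monomials suffice; linearity of [form] in its second argument comes
    from its symmetry. *)
Lemma form_op_ext (phi : nat -> nat -> R^o) (form : V -> V -> V)
    (op : {linear V -> V}) :
  (forall c u v g, form (c *: u + v) g = c *: form u g + form v g) ->
  (forall f g, form f g = form g f) ->
  (forall i j k l, linext phi (form (mon i j) (mon k l)) =
                   linext phi (op (mon i j) * mon k l)) ->
  forall f g, linext phi (form f g) = linext phi (op f * g).
Proof.
move=> forml formC H f g; move: f; apply: linear_form_ext => [c u v|c u v|i j].
- by rewrite forml linext_lin.
- by rewrite linearP mulrDl -scalerAl linext_lin.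
move: g; apply: linear_form_ext => [c u v|c u v|k l].
- by rewrite formC forml linext_lin !(formC (mon i j)).
- by rewrite mulrDr -scalerAr linext_lin.
exact: H.
Qed.

Hypothesis ha : -1 < a.

Lemma rect_formE (f g : V) :
  rect_functional a (rect_form f g) = rect_functional a (rect_op a f * g).
Proof.
by apply: form_op_ext;
  [exact: rect_form_lin|exact: rect_formC|exact: rect_form_sym_mon].
Qed.

Lemma tri_formE (f g : V) :
  tri_functional a (tri_form f g) = tri_functional a (tri_op a f * g).
Proof.
by apply: form_op_ext;
  [exact: tri_form_lin|exact: tri_formC|exact: tri_form_sym_mon].
Qed.

(** The operator leaves the power of x alone, and subtracting [lam j] lowers the exponent of y by
    one, so only [j] is counted. *)
Lemma eigensum_rect_mon i j : eigensum (rect_op a) lam j (mon i j).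
Proof.
elim: j i => [|j IH] i.
  exists (fun=> mon i 0); first by rewrite big_ord1.
  move=> k; rewrite leqn0 => /eqP ->.
  by rewrite /rect_op/= linext_mon /rect_op_mon mul0r scale0r subr0.
apply: eigensum_step; first exact: lam_lt.
rewrite /rect_op/= linext_mon /rect_op_mon addrAC subrr add0r -scaleNr.
exact: eigensumZ.
Qed.

(** Subtracting [lam (i + j)] leaves two monomials of total degree one less, or a zero coefficient
    when an exponent is 0. *)
Lemma eigensum_tri_mon i j : eigensum (tri_op a) lam (i + j) (mon i j).
Proof.
move En : (i + j)%N => n; elim: n i j En => [|n IH] i j En.
  move: En => /eqP; rewrite addn_eq0 => /andP[/eqP-> /eqP->].
  exists (fun=> mon 0 0); first by rewrite big_ord1.
  move=> k; rewrite leqn0 => /eqP ->.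
  by rewrite /tri_op/= linext_mon /tri_op_mon !mul0r !scale0r !subr0.
apply: eigensum_step; first exact: lam_lt.
rewrite /tri_op/= linext_mon /tri_op_mon En.
have E (u v w : V) : u - v - w - u = - v - w.
  by rewrite -!addrA addrC -!addrA addNr addr0.
rewrite E; apply: eigensumD; rewrite -scaleN1r; apply: eigensumZ.
  case: i En => [|i] En; first by rewrite mul0r scale0r; exact: eigensum0.
  by apply/eigensumZ/IH; case: En.
case: j En => [|j] En; first by rewrite mul0r scale0r; exact: eigensum0.
by apply/eigensumZ/IH; move: En; rewrite addnS => -[].
Qed.

(* The substitution [x |-> 2 - x]. *)
Definition flip (f : V) : V := mpoly.comp_mpoly [tuple 2 - varx; vary] f.

Lemma flip_lin c (u v : V) : flip (c *: u + v) = c *: flip u + flip v.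
Proof. by rewrite /flip mpoly.comp_mpolyD mpoly.comp_mpolyZ. Qed.

Lemma flip_sum (I : Type) (r : seq I) (F : I -> V) :
  flip (\sum_(i <- r) F i) = \sum_(i <- r) flip (F i).
Proof.
elim: r => [|i r IH]; first by rewrite !big_nil /flip mpoly.comp_mpoly0.
by rewrite !big_cons -IH -[F i]scale1r flip_lin !scale1r.
Qed.

Lemma flipZ c (u : V) : flip (c *: u) = c *: flip u.
Proof. by rewrite /flip mpoly.comp_mpolyZ. Qed.

Lemma flip_mon i j : flip (mon i j) = (2 - varx) ^+ i * vary ^+ j.
Proof.
rewrite /flip /monomial rmorphM/= !rmorphXn/= !mpoly.comp_mpolyXU.
by [].
Qed.

Lemma bieval_flip (f : V) z : bieval (flip f) z = bieval f (2 - z.1, z.2).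
Proof.
rewrite /bieval /flip mpoly.comp_mpoly_meval; apply: mpoly.meval_eq => i.
case: i => [[|[|//]] i2]; rewrite (tnth_nth 0)/=.
  by rewrite rmorphB/= mpoly.mevalXU/= rmorph_nat.
by rewrite mpoly.mevalXU.
Qed.

Lemma flip0 : flip 0 = 0.
Proof. exact: mpoly.comp_mpoly0. Qed.

Lemma flip1 : flip 1 = 1.
Proof. by rewrite /flip mpoly.comp_mpoly1. Qed.

Lemma flipM (f g : V) : flip (f * g) = flip f * flip g.
Proof. by rewrite /flip rmorphM. Qed.

Lemma flip_varx : flip varx = 2 - varx.
Proof. by rewrite {1}varxE flip_mon expr0 mulr1 expr1. Qed.

Lemma flip_vary : flip vary = vary.
Proof. by rewrite {1}varyE flip_mon expr0 mul1r expr1. Qed.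

Lemma dxM (f g : V) : dx (f * g) = dx f * g + f * dx g.
Proof. exact: mpoly.mderivM. Qed.

Lemma dyM (f g : V) : dy (f * g) = dy f * g + f * dy g.
Proof. exact: mpoly.mderivM. Qed.

Lemma mon00 : mon 0 0 = 1.
Proof. by rewrite /monomial !expr0 mulr1. Qed.

(** Chain rule: the sign is the derivative of 2 - x. The rule is checked on the variables, passes to
    powers and products by Leibniz, then to sums. *)
Lemma dx_flip (f : V) : dx (flip f) = - flip (dx f).
Proof.
have dx_vary : dx vary = 0 by rewrite varyE dx_mon scale0r.
have dx_varx : dx varx = 1 by rewrite varxE dx_mon scale1r mon00.
have dx1 : dx (1 : V) = 0 by rewrite -mon00 dx_mon scale0r.
have dx2 : dx (2 : V) = 0.
  by rewrite -[2]/(1 + 1) -[X in X + _]scale1r dx_lin dx1 scaler0 addr0.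
have dx2x : dx (2 - varx) = -1.
  by rewrite -scaleN1r addrC dx_lin dx_varx dx2 addr0 scaleN1r.
have ind (g h : V) : dx (flip g) = - flip (dx g) -> dx (flip h) = - flip (dx h) ->
    dx (flip (g * h)) = - flip (dx (g * h)).
  move=> Hg Hh; rewrite flipM !dxM Hg Hh -[dx g * h]scale1r flip_lin scale1r !flipM.
  by ring.
have indX (g : V) n : dx (flip g) = - flip (dx g) ->
    dx (flip (g ^+ n)) = - flip (dx (g ^+ n)).
  move=> Hg; elim: n => [|n IH]; last by rewrite exprS; exact: ind.
  by rewrite expr0 flip1 dx1 flip0 oppr0.
rewrite (bipolyE f); elim: (mpoly.msupp f) => [|m s IH].
  by rewrite !big_nil flip0 /dx mpoly.mderiv0 flip0 oppr0.
rewrite !big_cons flip_lin !dx_lin flip_lin IH opprD; congr (_ + _).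
rewrite -scalerN; congr (_ *: _).
apply: ind; apply: indX.
  by rewrite flip_varx dx2x dx_varx flip1.
by rewrite flip_vary dx_vary flip0 oppr0.
Qed.

Lemma dy_flip (f : V) : dy (flip f) = flip (dy f).
Proof.
have dy_varx : dy varx = 0 by rewrite varxE dy_mon scale0r.
have dy_vary : dy vary = 1 by rewrite varyE dy_mon scale1r mon00.
have dy1 : dy (1 : V) = 0 by rewrite -mon00 dy_mon scale0r.
have dy2 : dy (2 : V) = 0.
  by rewrite -[2]/(1 + 1) -[X in X + _]scale1r dy_lin dy1 scaler0 addr0.
have dy2x : dy (2 - varx) = 0.
  by rewrite -scaleN1r addrC dy_lin dy_varx dy2 addr0 scaler0.
have ind (g h : V) : dy (flip g) = flip (dy g) -> dy (flip h) = flip (dy h) ->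
    dy (flip (g * h)) = flip (dy (g * h)).
  move=> Hg Hh; rewrite flipM !dyM Hg Hh.
  by rewrite -[dy g * h]scale1r flip_lin scale1r !flipM.
have indX (g : V) n : dy (flip g) = flip (dy g) ->
    dy (flip (g ^+ n)) = flip (dy (g ^+ n)).
  move=> Hg; elim: n => [|n IH]; last by rewrite exprS; exact: ind.
  by rewrite expr0 flip1 dy1 flip0.
rewrite (bipolyE f); elim: (mpoly.msupp f) => [|m s IH].
  by rewrite !big_nil flip0 /dy mpoly.mderiv0 flip0.
rewrite !big_cons flip_lin !dy_lin flip_lin IH; congr (_ *: _ + _).
apply: ind; apply: indX.
  by rewrite flip_varx dy2x dy_varx flip0.
by rewrite flip_vary dy_vary flip1.
Qed.

(** The binomial expansion of (2 - x)^i has only powers up to [i], so the substitution does not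
    raise the total degree. *)
Lemma eigensum_flip_mon i j : eigensum (tri_op a) lam (i + j) (flip (mon i j)).
Proof.
rewrite flip_mon exprDn mulr_suml; apply: eigensum_sum => k _.
have -> : 2 ^+ (i - k) * (- varx) ^+ k *+ 'C(i, k) * vary ^+ j =
    (2 ^+ (i - k) * (-1) ^+ k * 'C(i, k)%:R : R) *: mon k j.
  have -> : (2 : V) = (2 : R) *: 1 by rewrite scaler_nat.
  rewrite -scaleN1r !exprZn expr1n -scaler_nat -!scalerAr -!scalerAl mul1r !scalerA.
  by congr (_ *: _); rewrite /GRing.scale/=; ring.
apply/eigensumZ/(@eigensumW _ _ _ _ (k + j)); last exact: eigensum_tri_mon.
by rewrite leq_add2r -ltnS.
Qed.

Lemma mem_msupp_in_Pi n (f : V) m : in_Pi n f -> m \in mpoly.msupp f ->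
  (m ix + m iy <= n)%N.
Proof.
move=> fn /mpoly.msize_mdeg_lt; rewrite mpoly.mdegE big_ord_recl big_ord1.
rewrite (_ : lift ord0 ord0 = iy); last exact/val_inj.
by move=> /leq_trans /(_ fn).
Qed.

Lemma eigensum_flip n (f : V) : in_Pi n f -> eigensum (tri_op a) lam n (flip f).
Proof.
move=> fn; rewrite (bipolyE f) flip_sum; apply: eigensum_sum => m mf.
rewrite flipZ; apply: eigensumZ.
by apply: eigensumW (eigensum_flip_mon _ _); exact: mem_msupp_in_Pi mf.
Qed.

Lemma eigensum_rect n (f : V) : in_Pi n f -> eigensum (rect_op a) lam n f.
Proof.
move=> fn; rewrite (bipolyE f); apply: eigensum_sum => m mf.
apply: eigensumZ; apply: eigensumW (eigensum_rect_mon _ _).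
exact: leq_trans (leq_addl _ _) (mem_msupp_in_Pi fn mf).
Qed.

(** Positivity on squares stays a hypothesis: it is not visible on moments and comes from the
    integral representation. *)
Lemma form_le n (phi : nat -> nat -> R^o) (form : V -> V -> V)
    (op : {linear V -> V}) f :
  (forall f g, form f g = form g f) ->
  (forall f g, linext phi (form f g) = linext phi (op f * g)) ->
  (forall u : V, 0 <= linext phi (u * u)) ->
  eigensum op lam n f ->
  linext phi (form f f) <= lam n * linext phi (f * f).
Proof.
move=> formC formE ge0 fn; rewrite formE.
apply: (@rayleigh_le _ _ op lam _ (fun u v => linext phi (u * v))) => //.
- exact: lam_lt.
- by move=> c u v w; rewrite mulrDl -scalerAl linext_lin.
- by move=> u v; rewrite mulrC.
- by move=> u v; rewrite -formE formC formE mulrC.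
Qed.

Lemma rect_form_le n (f : V) : in_Pi n f ->
  (forall u : V, 0 <= rect_functional a (u * u)) ->
  rect_functional a (rect_form f f) <= lam n * rect_functional a (f * f).
Proof.
move=> fn ge0; apply: form_le => //; first exact: rect_formC.
- exact: rect_formE.
- exact: eigensum_rect.
Qed.

Lemma tri_form_le n (f : V) : in_Pi n f ->
  (forall u : V, 0 <= tri_functional a (u * u)) ->
  tri_functional a (tri_form (flip f) (flip f)) <=
  lam n * tri_functional a (flip f * flip f).
Proof.
move=> fn ge0; apply: form_le => //; first exact: tri_formC.
- exact: tri_formE.
- exact: eigensum_flip.
Qed.

End RayleighBounds.

(** * Jacobi polynomials *)

Section Jacobi.
Variables (R : realType) (a : R).
Hypothesis ha : -1 < a.
Local Notation V := (bipoly R).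
Local Notation mon := (monomial R).
Local Notation lam := (lam a).

Lemma in_yM (p q : {poly R}) : in_y (p * q) = in_y p * in_y q.
Proof. by rewrite /in_y rmorphM. Qed.

Lemma in_yD (p q : {poly R}) : in_y (p + q) = in_y p + in_y q.
Proof. by rewrite /in_y rmorphD. Qed.

Lemma in_yZ c (p : {poly R}) : in_y (c *: p) = c *: in_y p.
Proof. by rewrite /in_y linearZ/= mulr_algl. Qed.

Lemma in_yXn k : in_y ('X^k : {poly R}) = mon 0 k.
Proof. by rewrite /in_y rmorphXn/= horner_algX /monomial expr0 mul1r. Qed.

Lemma in_yE (p : {poly R}) : in_y p = \sum_(k < size p) p`_k *: mon 0 k.
Proof.
rewrite -{1}[p]coefK poly_def /in_y linear_sum; apply: eq_bigr => k _.
by rewrite -[LHS]/(in_y _) in_yZ in_yXn.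
Qed.

Lemma dx_sum (I : Type) (r : seq I) (F : I -> V) :
  dx (\sum_(i <- r) F i) = \sum_(i <- r) dx (F i).
Proof.
elim: r => [|i r IH]; first by rewrite !big_nil /dx mpoly.mderiv0.
by rewrite !big_cons -IH -[F i]scale1r dx_lin !scale1r.
Qed.

Lemma dxZ c (f : V) : dx (c *: f) = c *: dx f.
Proof. exact: mpoly.mderivZ. Qed.

Lemma dyZ c (f : V) : dy (c *: f) = c *: dy f.
Proof. exact: mpoly.mderivZ. Qed.

Lemma dx_in_y (p : {poly R}) : dx (in_y p) = 0.
Proof.
by rewrite in_yE dx_sum big1// => k _; rewrite dxZ dx_mon scale0r scaler0.
Qed.

Lemma dy_in_y (p : {poly R}) : dy (in_y p) = in_y p^`().
Proof.
elim/poly_ind: p => [|p c IH].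
  by rewrite deriv0 {2}/in_y rmorph0 in_yE size_poly0 big_ord0 /dy mpoly.mderiv0.
rewrite derivD derivM derivX derivC addr0 mulr1 in_yD in_yM !in_yD in_yM.
have -> : in_y 'X = mon 0 1 by rewrite -in_yXn.
rewrite -{1}[in_y p * _]scale1r dy_lin dyM IH dy_mon !scale1r mon00 mulr1.
have -> : in_y c%:P = c *: mon 0 0 by rewrite -in_yXn -in_yZ expr0 alg_polyC.
by rewrite dyZ dy_mon scale0r scaler0 addr0.
Qed.

Lemma flip_in_y (p : {poly R}) : flip (in_y p) = in_y p.
Proof.
rewrite in_yE flip_sum; apply: eq_bigr => k _.
by rewrite flipZ flip_mon /monomial !expr0.
Qed.

(** For [i = 0] both moments are 1 / ((j + a + 1) (j + a + 2)). *)
Lemma functional_in_y (p : {poly R}) :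
  tri_functional a (in_y p) = rect_functional a (in_y p).
Proof.
rewrite in_yE !linear_sum; apply: eq_bigr => k _.
rewrite /tri_functional /rect_functional/= !linextZ !linext_mon.
by rewrite /tri_moment /rect_moment !add0r mul1r.
Qed.

Lemma rect_form_in_y (p : {poly R}) :
  rect_form (in_y p) (in_y p) = in_y ('X * (1 - 'X) * p^`() * p^`()).
Proof.
have -> : 1 - 'X = 1 + (-1) *: 'X :> {poly R} by rewrite scaleN1r.
rewrite /rect_form dy_in_y !in_yM in_yD in_yZ varyE.
have -> : in_y 'X = mon 0 1 by rewrite -in_yXn.
by rewrite scaleN1r /in_y rmorph1.
Qed.

Lemma tri_form_in_y (p : {poly R}) :
  tri_form (in_y p) (in_y p) = rect_form (in_y p) (in_y p).
Proof. by rewrite /tri_form /rect_form dx_in_y; ring. Qed.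

Variable n : nat.

(* The power series recursion for [L p = lam n p]; it starts from [P 1], since
   [u = 1] is [y = 0]. *)
Fixpoint jacobi_coef (k : nat) : R :=
  if k is k'.+1 then
    jacobi_coef k' * ((lam k' - lam n) / (k'.+1%:R * (k'.+1%:R + a)))
  else \prod_(i < n) ((a + i.+1%:R) / i.+1%:R).

Definition shifted_jacobi : {poly R} := \poly_(k < n.+1) jacobi_coef k.

(** The factors [lam k - lam n] vanish only from [k = n] on, where the series stops; hence the
    degree is exactly [n]. *)
Lemma jacobi_coef_neq0 k : (k <= n)%N -> jacobi_coef k != 0.
Proof.
have pos i : 0 < a + i.+1%:R.
  by rewrite -natr1; have : 0 <= i%:R :> R by []; move=> ?; have := ha; move=> ?; lra.
elim: k => [_|k IH kn] /=.
  by apply/prodf_neq0 => i _; rewrite mulf_neq0 ?invr_neq0 ?lt0r_neq0.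
rewrite mulf_neq0 ?IH 1?ltnW// mulf_neq0//.
  by rewrite subr_eq0 lt_eqF// lam_lt.
by rewrite invr_neq0// mulf_neq0// addrC lt0r_neq0.
Qed.

Lemma size_shifted_jacobi : size shifted_jacobi = n.+1.
Proof. by rewrite size_poly_eq// jacobi_coef_neq0. Qed.

Lemma in_y_shifted_jacobi :
  in_y shifted_jacobi = \sum_(k < n.+1) jacobi_coef k *: mon 0 k.
Proof.
rewrite in_yE size_shifted_jacobi; apply: eq_bigr => k _.
by rewrite coef_poly ltn_ord.
Qed.

Lemma rect_op_shifted_jacobi :
  rect_op a (in_y shifted_jacobi) = lam n *: in_y shifted_jacobi.
Proof.
have pos i : 0 < i.+1%:R + a.
  by rewrite -natr1; have : 0 <= i%:R :> R by []; move=> ?; have := ha; move=> ?; lra.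
rewrite in_y_shifted_jacobi linear_sum scaler_sumr; apply/eqP.
rewrite -subr_eq0 -sumrB.
have E k : rect_op a (jacobi_coef k *: mon 0 k) -
    lam n *: (jacobi_coef k *: mon 0 k) =
    (jacobi_coef k * (lam k - lam n)) *: mon 0 k
    - (jacobi_coef k * (k%:R * (k%:R + a))) *: mon 0 k.-1.
  rewrite linearZ/= /rect_op/= linext_mon /rect_op_mon scalerBr !scalerA.
  by rewrite mulrBr scalerBl [lam n * _]mulrC addrAC.
under eq_bigr do rewrite E.
(* The first sum loses its top term and the second its bottom one; after an index shift the
   recursion matches them termwise. *)
rewrite sumrB big_ord_recr/= subrr mulr0 scale0r addr0.
rewrite big_ord_recl/= mul0r mulr0 scale0r add0r -sumrB big1// => k _.
rewrite /bump/= add1n -scalerBl; apply/eqP; rewrite scaler_eq0.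
apply/orP; left; rewrite subr_eq0; apply/eqP.
rewrite -mulrA; congr (_ * _); rewrite mulfVK//.
by rewrite mulf_neq0// lt0r_neq0.
Qed.

Lemma rect_opC (f g : V) :
  rect_functional a (rect_op a f * g) = rect_functional a (f * rect_op a g).
Proof. by rewrite -rect_formE// rect_formC rect_formE// mulrC. Qed.

(** Symmetry against y^j gives (lam n - lam j) <w, y^j> = - j (j + a) <w, y^(j-1)>, so the moments
    of the eigenvector w vanish by induction on j < n. *)
Lemma shifted_jacobi_orthogonal (q : {poly R}) : (size q <= n)%N ->
  rect_functional a (in_y (shifted_jacobi * q)) = 0.
Proof.
move=> qn; rewrite in_yM [in_y q]in_yE mulr_sumr linear_sum big1// => k _.
have kn : (k < n)%N := leq_trans (ltn_ord k) qn.
rewrite -scalerAr /rect_functional/= linextZ.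
apply/eqP; rewrite mulf_eq0; apply/orP; right; apply/eqP.
set w := in_y shifted_jacobi.
have key j : rect_functional a (w * ((j%:R * (j%:R + a)) *: mon 0 j.-1)) = 0 ->
    (j < n)%N -> linext (rect_moment a : _ -> _ -> R^o) (w * mon 0 j) = 0.
  move=> j0 jn; have := rect_opC w (mon 0 j).
  rewrite rect_op_shifted_jacobi -scalerAl /rect_op/= linext_mon mulrBr.
  rewrite /rect_functional/= in j0 *.
  rewrite linextD linextN j0 subr0 -scalerAr !linextZ => /eqP.
  rewrite -subr_eq0 -mulrBl mulf_eq0 => /orP[|/eqP//].
  by rewrite subr_eq0 gt_eqF// lam_lt.
elim: (nat_of_ord k) kn => {k}[|k IH] kn; apply: key => //.
  by rewrite mul0r scale0r mulr0 linear0.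
by rewrite -scalerAr /rect_functional/= linextZ IH ?mulr0// ltnW.
Qed.

Definition jacobi : {poly R} := shifted_jacobi \Po (2^-1 *: (1 - 'X)).

Lemma horner_jacobi u : jacobi.[u] = shifted_jacobi.[(1 - u) / 2].
Proof. by rewrite /jacobi horner_comp !hornerE mulrC. Qed.

Lemma shifted_of_jacobi : shifted jacobi = shifted_jacobi.
Proof.
rewrite /shifted /jacobi -comp_polyA comp_polyZ comp_polyB comp_polyX.
rewrite (comp_polyC 1) opprB addrC subrK scalerA mulVf ?pnatr_eq0// scale1r.
by rewrite comp_polyXr.
Qed.

Lemma size_jacobi : size jacobi = n.+1.
Proof.
rewrite /jacobi size_comp_poly2 ?size_shifted_jacobi//.
rewrite size_scale ?invr_neq0 ?pnatr_eq0// -opprB size_polyN.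
by rewrite -[1]/(1%:P) size_XsubC.
Qed.

Lemma jacobi1 : jacobi.[1] = \prod_(i < n) ((a + i.+1%:R) / i.+1%:R).
Proof. by rewrite horner_jacobi subrr mul0r horner_coef0 coef_poly. Qed.

Lemma rect_form_jacobi (p := in_y shifted_jacobi) :
  rect_functional a (rect_form p p) = lam n * rect_functional a (p * p).
Proof.
by rewrite rect_formE// rect_op_shifted_jacobi -scalerAl /rect_functional/= linextZ.
Qed.

Lemma tri_form_jacobi (p := in_y shifted_jacobi) :
  tri_functional a (tri_form (flip p) (flip p)) =
  lam n * tri_functional a (flip p * flip p).
Proof.
rewrite flip_in_y tri_form_in_y rect_form_in_y -in_yM.
by rewrite !functional_in_y -rect_form_in_y in_yM rect_form_jacobi.
Qed.

End Jacobi.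

(** * Integration of monomials *)

Section ImproperFTC.
Variable R : realType.
Local Notation mu := (@lebesgue_measure R).

(** Exhaust the open interval by compact ones: monotone convergence handles the integrals, one-sided
    continuity of [F] the boundary values. This covers integrands unbounded at an endpoint. *)
Lemma ge0_FTC2_oo (f F : R -> R) (l r : R) : l < r ->
  (forall x, l < x < r -> 0 <= f x) ->
  {in `]l, r[, continuous f} ->
  derivable_oo_LRcontinuous F l r ->
  {in `]l, r[, (F^`())%classic =1 f} ->
  (\int[mu]_(x in `[l, r]) (f x)%:E = (F r)%:E - (F l)%:E)%E.
Proof.
move=> lr f0 cf [dF Fl Fr] F'f.
(* A third of the length keeps [l + d n < r - d n] already at [n = 0]. *)
pose d (n : nat) : R := (r - l) / 3 * n.+1%:R^-1.
have rl : 0 < r - l by rewrite subr_gt0.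
have d0 n : 0 < d n by rewrite mulr_gt0// divr_gt0.
have dle n m : (n <= m)%N -> d m <= d n.
  by move=> nm; rewrite ler_pM2l ?divr_gt0// lef_pV2 ?posrE// ler_nat.
have dlt n : l + d n < r - d n.
  have := dle 0%N n isT; rewrite {2}/d invr1 mulr1.
  by move=> ?; lra.
have dcvg : d n @[n --> \oo] --> 0.
  rewrite -[X in _ --> X](mulr0 ((r - l) / 3)); apply: cvgMr.
  exact: cvg_harmonic.
have mf : measurable_fun `]l, r[ f.
  apply: open_continuous_measurable_fun; first exact: interval_open.
  by move=> x; rewrite inE; exact: cf.
rewrite integral_itv_bndoo; last exact/measurable_EFinP.
pose A n := `[l + d n, r - d n]%classic.
have Aoo n : A n `<=` `]l, r[.
  move=> x; rewrite /A/= !in_itv/= => /andP[x1 x2]; apply/andP; split.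
    by apply: lt_le_trans x1; rewrite ltrDl.
  by apply: le_lt_trans x2 _; rewrite ltrBlDr ltrDl.
have UA : \bigcup_n A n = `]l, r[%classic.
  apply/seteqP; split=> [x [n _]|x]; first exact: Aoo.
  rewrite /= in_itv/= => /andP[lx xr].
  have e0 : 0 < Num.min (x - l) (r - x) by rewrite lt_min !subr_gt0 lx.
  have [N _ HN] := (cvgr_lt _ dcvg) _ e0.
  exists N => //; rewrite /A/= in_itv/=; have := HN N (leqnn _).
  by rewrite lt_min => /andP[? ?]; apply/andP; split; lra.
have IA n : (\int[mu]_(x in A n) (f x)%:E = (F (r - d n) - F (l + d n))%:E)%E.
  have cF x : x \in `]l, r[ -> {for x, continuous F}.
    by move=> xlr; apply/differentiable_continuous/derivable1_diffP/dF.
  have sub : {subset `[l + d n, r - d n] <= `]l, r[} by move=> x; exact: Aoo.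
  rewrite EFinB (@continuous_FTC2 _ f F)//.
  - by apply: continuous_in_subspaceT => x; rewrite inE => /sub; exact: cf.
  - split.
    + by move=> x xA; apply/dF/sub; apply: subset_itv_oo_cc.
    + apply: cvg_at_right_filter; apply: cF; apply: sub.
      by rewrite in_itv/= lexx ltW.
    + apply: cvg_at_left_filter; apply: cF; apply: sub.
      by rewrite in_itv/= lexx ltW.
  - by move=> x xA; apply/F'f/sub; apply: subset_itv_oo_cc.
have cvgI : (\int[mu]_(x in A n) (f x)%:E)%E @[n --> \oo] -->
    (\int[mu]_(x in `]l, r[) (f x)%:E)%E.
  rewrite -UA; apply: ge0_nondecreasing_set_cvg_integral => //.
  - apply/nondecreasing_seqP => n; apply/subsetPset => x.
    rewrite /A/= !in_itv/= => /andP[x1 x2]; have := dle _ _ (leqnSn n).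
    by move=> ?; apply/andP; split; lra.
  - by move=> n; exact: measurable_itv.
  - by move=> n; apply/measurable_EFinP; apply: measurable_funS mf; [|exact: Aoo].
  - move=> n x /Aoo; rewrite /= in_itv/= => lxr; rewrite lee_fin; exact: f0.
rewrite (funext IA) in cvgI; apply: (cvg_unique _ cvgI) => //.
rewrite -EFinB; apply: cvg_EFin; first exact: nearW.
apply: cvgB.
- move/cvg_at_leftP : Fr; apply; split; first by move=> n; rewrite ltrBlDr ltrDl.
  by rewrite -[X in _ --> X]subr0; apply: cvgB => //; exact: cvg_cst.
- move/cvg_at_rightP : Fl; apply; split; first by move=> n; rewrite ltrDl.
  by rewrite -[X in _ --> X]addr0; apply: cvgD => //; exact: cvg_cst.
Qed.

End ImproperFTC.

(** * Integrals of real powers *)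

Section PowerIntegrals.
Variable R : realType.
Local Notation mu := (@lebesgue_measure R).

Lemma is_derive_powR_div (b x : R) : -1 < b -> 0 < x ->
  is_derive x 1 (fun y => y `^ (b + 1) / (b + 1)) (x `^ b).
Proof.
move=> b1 x0; have bn0 : b + 1 != 0 by rewrite lt0r_neq0//; lra.
have -> : (fun y => y `^ (b + 1) / (b + 1)) =
    (b + 1)^-1 \*: (fun y : R => y `^ (b + 1)).
  by apply/funext => y; rewrite /= mulrC.
have := is_derive1_powR (b + 1) x0 => H.
apply: is_derive_eq; rewrite addrK /GRing.scale/= mulrA mulVf ?mul1r//.
Qed.

Lemma continuous_powR_gt0 (b x : R) :
  0 < x -> {for x, continuous (fun y : R => y `^ b)}.
Proof.
move=> x0; apply/differentiable_continuous/derivable1_diffP.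
by apply: ex_derive; exact: is_derive1_powR.
Qed.

Lemma integral_powR (b s : R) : -1 < b -> 0 <= s ->
  (\int[mu]_(y in `[0%R, s]) (y `^ b)%:E = (s `^ (b + 1) / (b + 1))%:E)%E.
Proof.
move=> b1; have b0 : 0 < b + 1 by lra.
rewrite le_eqVlt => /predU1P[<-|s0].
  by rewrite set_itv1 integral_set1 powR0 ?mul0r// lt0r_neq0.
pose F y := y `^ (b + 1) / (b + 1).
have dF (x : R) : 0 < x -> is_derive x (1 : R) F (x `^ b) by exact: is_derive_powR_div.
rewrite (@ge0_FTC2_oo _ _ F)//.
- by rewrite /F powR0 ?lt0r_neq0// mul0r sube0.
- by move=> x _; exact: powR_ge0.
- by move=> x; rewrite in_itv/= => /andP[x0 _]; exact: continuous_powR_gt0.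
- split.
  + by move=> x; rewrite in_itv/= => /andP[x0 _]; apply: ex_derive; exact: dF.
  + rewrite /F powR0 ?lt0r_neq0// mul0r -[X in _ --> X](mul0r (b + 1)^-1).
    by apply: cvgMl; exact: powR_cvg0.
  + apply: cvg_at_left_filter; apply/differentiable_continuous/derivable1_diffP.
    by apply: ex_derive; exact: dF.
- move=> x; rewrite in_itv/= => /andP[x0 _].
  by rewrite derive1E; apply: derive_val; exact: dF.
Qed.

(** Reflected antiderivative. It serves with [d = 2] for powers of 2 - x on [1, 2], and with [d = 1]
    for the Jacobi weight on [-1, 1]. *)
Lemma integral_powR_subl (d s b : R) : -1 < b -> 0 <= s ->
  (\int[mu]_(u in `[(d - s)%R, d]) ((d - u) `^ b)%:E =
   (s `^ (b + 1) / (b + 1))%:E)%E.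
Proof.
move=> b1; have b0 : 0 < b + 1 by lra.
rewrite le_eqVlt => /predU1P[<-|s0].
  by rewrite subr0 set_itv1 integral_set1 powR0 ?mul0r// lt0r_neq0.
pose F u := - ((d - u) `^ (b + 1) / (b + 1)).
have dF (x : R) : x < d -> is_derive x (1 : R) F ((d - x) `^ b).
  rewrite -subr_gt0 => xd.
  have := is_derive_powR_div b1 xd => H.
  have H2 : is_derive x (1 : R) (fun u : R => d - u) (-1).
    by have := is_deriveB (is_derive_cst d x 1) (is_derive_id x 1); rewrite sub0r.
  have := @is_derive1_comp _ (fun y => y `^ (b + 1) / (b + 1))
    (fun u => d - u) x _ _ H H2.
  move=> H3; apply: is_derive_eq.
  by rewrite mulrN1 opprK.
rewrite (@ge0_FTC2_oo _ _ F)//.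
- rewrite /F subrr powR0 ?lt0r_neq0// mul0r oppr0 sub0e opprB addrC subrK.
  by rewrite EFinN oppeK.
- by rewrite ltrBlDr ltrDl.
- by move=> x _; exact: powR_ge0.
- move=> x; rewrite in_itv/= => /andP[_ xd].
  apply: (@continuous_comp _ _ _ (fun u => d - u) (fun y : R => y `^ b)).
    by apply: cvgB; [exact: cvg_cst|exact: cvg_id].
  by apply: continuous_powR_gt0; rewrite subr_gt0.
- split.
  + by move=> x; rewrite in_itv/= => /andP[_ xd]; apply: ex_derive; exact: dF.
  + apply: cvg_at_right_filter; apply/differentiable_continuous/derivable1_diffP.
    by apply: ex_derive; apply: dF; rewrite ltrBlDr ltrDl.
  + rewrite {2}/F subrr powR0 ?lt0r_neq0// mul0r.
    apply: cvgN; rewrite -[X in _ --> X](mul0r (b + 1)^-1).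
    (* The left limit at [d] becomes a right limit at 0 along sequences. *)
    apply: cvgMl; apply/cvg_at_leftP => u [ud ucvg].
    have /cvg_at_rightP := powR_cvg0 b0.
    move=> /(_ (fun n => d - u n)); apply; split.
      by move=> n; rewrite subr_gt0.
    by rewrite -[X in _ --> X](subrr d); apply: cvgB => //; exact: cvg_cst.
- move=> x; rewrite in_itv/= => /andP[_ xd].
  by rewrite derive1E; apply: derive_val; exact: dF.
Qed.

End PowerIntegrals.

(** * From moments to integrals of polynomials *)

Section HasIntegral.
Context d (T : measurableType d) (R : realType) (mu : {measure set T -> \bar R}).
Variables (D : set T) (mD : measurable D).

(** Polynomials are signed combinations of monomials, so additivity needs integrability along with
    the value. *)
Definition has_integral (f : T -> R) (v : R) : Prop :=
  mu.-integrable D (EFin \o f) /\ (\int[mu]_(x in D) (f x)%:E = v%:E)%E.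

Lemma has_integral_lin c (f g : T -> R) u v : has_integral f u -> has_integral g v ->
  has_integral (fun x => c * f x + g x) (c * u + v).
Proof.
move=> [If fu] [Ig gv]; have Icf := integrableZl mD c If; split.
  exact: (integrableD mD Icf Ig).
have := integralD mD Icf Ig; rewrite integralZl//= fu gv EFinD EFinM => <-.
by apply: eq_integral => x _.
Qed.

Lemma has_integral0 : has_integral (fun=> 0) 0.
Proof.
split; first exact: (integrable0 mu D).
by rewrite integral0_eq.
Qed.

Lemma has_integralZ c (f : T -> R) u : has_integral f u ->
  has_integral (fun x => c * f x) (c * u).
Proof.
move=> If; have := has_integral_lin c If has_integral0.
by rewrite addr0; under eq_fun do rewrite addr0.
Qed.

Lemma ge0_has_integral (f : T -> R) v : measurable_fun D f ->
  (forall x, D x -> 0 <= f x) -> (\int[mu]_(x in D) (f x)%:E = v%:E)%E ->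
  has_integral f v.
Proof.
move=> mf f0 fv; split => //; apply/integrableP; split; first exact/measurable_EFinP.
rewrite (eq_integral (EFin \o f)); last first.
  by move=> x /[!inE] Dx; rewrite /= ger0_norm// f0.
by rewrite fv ltry.
Qed.

Lemma eq_has_integral (f g : T -> R) v : (forall x, D x -> f x = g x) ->
  has_integral f v -> has_integral g v.
Proof.
move=> fg [If fv]; split.
  by apply: eq_integrable If => // x /[!inE] Dx; rewrite /= fg.
by rewrite -fv; apply: eq_integral => x /[!inE] Dx; rewrite fg.
Qed.

(** The map [s] allows for the identity on the square, x to 2 - x on the triangle, and a line
    embedded in the plane. *)
Lemma has_integral_linext (s : T -> R * R) (w : T -> R) (phi : nat -> nat -> R^o) :
  (forall i j,
    has_integral (fun z => bieval (monomial R i j) (s z) * w z) (phi i j)) ->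
  forall p, has_integral (fun z => bieval p (s z) * w z) (linext phi p).
Proof.
move=> H p.
have E z : bieval p (s z) = \sum_(m <- mpoly.msupp p)
    mpoly.mcoeff m p * bieval (monomial R (m ix) (m iy)) (s z).
  rewrite {1}(bipolyE p); elim: (mpoly.msupp p) => [|m r IH].
    by rewrite !big_nil /bieval mpoly.meval0.
  by rewrite !big_cons bievalD bievalZ IH.
under eq_fun do rewrite E.
rewrite /linext; elim: (mpoly.msupp p) => [|m r IH].
  rewrite big_nil; under eq_fun do rewrite big_nil mul0r.
  exact: has_integral0.
rewrite big_cons; under eq_fun do rewrite big_cons mulrDl -mulrA.
exact: has_integral_lin.
Qed.

End HasIntegral.

(** * Moments of the square and of the triangle by iterated integration *)

Section Tonelli.
Variable R : realType.
Local Notation mu := (@lebesgue_measure R).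
Local Notation plane := (measurableTypeR R * measurableTypeR R)%type.

Lemma integral_xsection (E : set plane) (h : R * R -> R) :
  measurable E -> measurable_fun E h -> (forall z, E z -> 0 <= h z) ->
  (\int[mu \x mu]_(z in E) (h z)%:E =
   \int[mu]_x \int[mu]_(y in xsection E x) (h (x, y))%:E)%E.
Proof.
move=> mE mh h0; rewrite integral_mkcond fubini_tonelli1; last 2 first.
- by apply/(measurable_restrictT _ mE); exact/measurable_EFinP.
- by move=> z; apply: erestrict_ge0 => t Et; rewrite lee_fin h0.
apply: eq_integral => x _; rewrite /fubini_F [RHS]integral_mkcond.
by apply: eq_integral => y _; rewrite /patch mem_xsection.
Qed.

Lemma exprn_powR (a y : R) j : -1 < a -> 0 <= y ->
  y ^+ j * y `^ a = y `^ (a + j%:R).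
Proof.
move=> a1; rewrite le_eqVlt => /predU1P[<-|y0].
  case: j => [|j]; first by rewrite expr0 mul1r addr0.
  (* At [y = 0] the real power is 0 because its exponent [a + j.+1] is nonzero. *)
  rewrite expr0n mul0r powR0// lt0r_neq0// -natr1.
  by have : 0 <= j%:R :> R by []; move=> ?; lra.
by rewrite addrC powRD ?(gt_eqF y0) ?implybT// powR_mulrn// ltW.
Qed.

Definition unit_square : set (R * R) := `[0, 1] `*` `[0, 1].
(** The line x = 1 is left to the square, so that the trapezoid is a disjoint union. *)
Definition right_part : set (R * R) :=
  [set z | 1 < z.1 <= 2 /\ 0 <= z.2 <= 2 - z.1].

Lemma measurable_unit_square : measurable (unit_square : set plane).
Proof. by apply: measurableX; exact: measurable_itv. Qed.

Lemma measurable_right_part : measurable (right_part : set plane).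
Proof.
have m1 : measurable_fun [set: plane] (fun z => 2 - z.1).
  by apply: measurable_funB => //; exact: measurable_fst.
have -> : right_part = (`]1, 2] `*` setT) `&` (setT `*` `[0, +oo[) `&`
   (setT `&` [set z | z.2 <= 2 - z.1]).
  apply/seteqP; split=> z /=; rewrite !in_itv/= ?andbT.
    by move=> [H /andP[H1 H2]].
  by move=> [[[H _] [_ H1]] [_ H2]]; split => //; rewrite H1.
apply: measurableI; last exact: measurable_fun_le.
by apply: measurableI; apply: measurableX => //; exact: measurable_itv.
Qed.

Lemma measurable_bieval (p : bipoly R) : measurable_fun [set: plane] (bieval p).
Proof.
rewrite (_ : bieval p = fun z => \sum_(m <- mpoly.msupp p)
    mpoly.mcoeff m p * (z.1 ^+ m ix * z.2 ^+ m iy)); last first.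
  apply/funext => z; rewrite {1}(bipolyE p).
  elim: (mpoly.msupp p) => [|m r IH]; first by rewrite !big_nil /bieval mpoly.meval0.
  by rewrite !big_cons bievalD bievalZ IH bieval_mon.
apply: measurable_sum => m.
apply: measurable_funM => //; apply: measurable_funM; apply: measurable_funX.
- exact: measurable_fst.
- exact: measurable_snd.
Qed.

Lemma measurable_snd_powR (a : R) : measurable_fun [set: plane] (fun z => z.2 `^ a).
Proof. by apply: (measurableT_comp (measurable_powR a)); exact: measurable_snd. Qed.

Lemma has_integral_powR (b s : R) : -1 < b -> 0 <= s ->
  has_integral mu `[0, s] (fun y => y `^ b) (s `^ (b + 1) / (b + 1)).
Proof.
move=> b1 s0; apply: ge0_has_integral => //.
- by apply: measurable_funTS; exact: measurable_powR.
- by move=> x _; exact: powR_ge0.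
- exact: integral_powR.
Qed.

Variable a : R.
Hypothesis ha : -1 < a.

Lemma natr_gtN1 (j : nat) : -1 < a + j%:R.
Proof. by have : 0 <= j%:R :> R by []; have := ha; move=> ? ?; lra. Qed.

Lemma has_integral_jacobi_weight j :
  has_integral mu `[0, 1] (fun y => y ^+ j * (y `^ a * (1 - y)))
   ((j%:R + a + 1) * (j%:R + a + 2))^-1.
Proof.
have aj := natr_gtN1 j.
have I1 := has_integral_powR aj ler01.
have aj1 : -1 < a + j.+1%:R := natr_gtN1 j.+1.
have I2 := has_integral_powR aj1 ler01.
have mI : measurable (`[0, 1]%classic : set (measurableTypeR R)).
  exact: measurable_itv.
(* The factor 1 - y splits the weight into y^(a+j) - y^(a+j+1). *)
have := has_integral_lin mI (-1) I2 I1; rewrite !powR1 => H.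
rewrite (_ : _^-1 = -1 * (1 / (a + j.+1%:R + 1)) + 1 / (a + j%:R + 1)).
  apply: eq_has_integral H; first exact: measurable_itv.
  move=> y; rewrite /= in_itv/= => /andP[y0 y1].
  by rewrite -!exprn_powR// exprS; ring.
by field; apply/andP; split; apply: lt0r_neq0; move: ha (aj) => ? ?;
  rewrite -?natr1; lra.
Qed.

Lemma has_integral_exprn (i : nat) :
  has_integral mu `[0, 1] (fun x => x ^+ i) (i%:R + 1)^-1.
Proof.
have i1 : -1 < i%:R :> R by have : 0 <= i%:R :> R by []; move=> ?; lra.
have := has_integral_powR i1 ler01; rewrite powR1 div1r => H.
apply: eq_has_integral H; first exact: measurable_itv.
by move=> x; rewrite /= in_itv/= => /andP[x0 _]; rewrite powR_mulrn.
Qed.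

Lemma has_integral_unit_square (p : bipoly R) :
  has_integral (mu \x mu)%E unit_square (fun z => bieval p z * (z.2 `^ a * (1 - z.2)))
    (rect_functional a p).
Proof.
rewrite /rect_functional/=.
apply: (@has_integral_linext _ _ _ _ _ measurable_unit_square id
  (fun z => z.2 `^ a * (1 - z.2)) (rect_moment a)) => i j.
have mf : measurable_fun [set: plane]
    (fun z => bieval (monomial R i j) z * (z.2 `^ a * (1 - z.2))).
  apply: measurable_funM; first exact: measurable_bieval.
  apply: measurable_funM; first exact: measurable_snd_powR.
  by apply: measurable_funB => //; exact: measurable_snd.
have f0 z : unit_square z -> 0 <= bieval (monomial R i j) z * (z.2 `^ a * (1 - z.2)).
  move=> [/=]; rewrite !in_itv/= => /andP[x0 x1] /andP[y0 y1].
  by rewrite bieval_mon !mulr_ge0 ?exprn_ge0 ?powR_ge0 ?subr_ge0.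
apply: ge0_has_integral => //; first exact: measurable_funTS.
rewrite integral_xsection//; [|exact: measurable_unit_square|exact: measurable_funTS].
pose c := ((j%:R + a + 1) * (j%:R + a + 2))^-1.
transitivity (\int[mu]_(x in `[0%R, 1%R]) (c * x ^+ i)%:E)%E.
  rewrite [RHS]integral_mkcond; apply: eq_integral => x _; rewrite /patch.
  case: ifPn => [x01|x01]; last first.
    by rewrite /unit_square notin_xsectionX// integral_set0.
  rewrite /unit_square in_xsectionX// mulrC.
  have mI : measurable (`[0%R, 1%R]%classic : set (measurableTypeR R)).
    exact: measurable_itv.
  have [_ <-] := has_integralZ mI (x ^+ i) (has_integral_jacobi_weight j).
  apply: eq_integral => y _.
  by rewrite bieval_mon/= -mulrA.
have mI : measurable (`[0%R, 1%R]%classic : set (measurableTypeR R)).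
  exact: measurable_itv.
have [_ ->] := has_integralZ mI c (has_integral_exprn i).
by rewrite /rect_moment /c [in RHS]invfM mulrC.
Qed.

Lemma xsection_right_part x :
  xsection right_part x = if 1 < x <= 2 then `[0, 2 - x]%classic else set0.
Proof.
apply/seteqP; split=> y /=.
  by move=> /xsectionP[/= -> yx]; rewrite /= in_itv.
case: ifPn => // x12; rewrite /= in_itv/= => y0.
by apply/xsectionP.
Qed.

Lemma has_integral_right_part (p : bipoly R) :
  has_integral (mu \x mu)%E right_part (fun z => bieval p (2 - z.1, z.2) * z.2 `^ a)
    (tri_functional a p).
Proof.
rewrite /tri_functional/=.
apply: (@has_integral_linext _ _ _ _ _ measurable_right_part (fun z => (2 - z.1, z.2))
  (fun z => z.2 `^ a) (tri_moment a)) => i j.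
have mf : measurable_fun [set: plane]
    (fun z => bieval (monomial R i j) (2 - z.1, z.2) * z.2 `^ a).
  apply: measurable_funM; last exact: measurable_snd_powR.
  under eq_fun do rewrite -bieval_flip.
  exact: measurable_bieval.
have f0 z : right_part z -> 0 <= bieval (monomial R i j) (2 - z.1, z.2) * z.2 `^ a.
  move=> [/andP[x1 x2] /andP[y0 y1]].
  by rewrite bieval_mon !mulr_ge0 ?exprn_ge0 ?powR_ge0 ?subr_ge0.
apply: ge0_has_integral => //; first exact: measurable_funTS.
rewrite integral_xsection//; [|exact: measurable_right_part|exact: measurable_funTS].
have aj := natr_gtN1 j.
have aij : -1 < a + j%:R + 1 + i%:R.
  by have : 0 <= i%:R :> R by []; move: (aj) => ? ?; lra.
(* With s = 2 - x, integrating s^i y^(a+j) over 0 <= y <= s gives s^(a+j+1+i) / (a+j+1). *)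
transitivity (\int[mu]_(x in `]1%R, 2%R])
    ((a + j%:R + 1)^-1 * (2 - x) `^ (a + j%:R + 1 + i%:R))%:E)%E.
  rewrite [RHS]integral_mkcond; apply: eq_integral => x _.
  rewrite xsection_right_part /patch mem_setE in_itv/=.
  case: ifPn => [/andP[x1 x2]|_]; last by rewrite integral_set0.
  have x0 : 0 <= 2 - x by rewrite subr_ge0.
  have mI : measurable (`[0%R, 2 - x]%classic : set (measurableTypeR R)).
    exact: measurable_itv.
  have a1 : -1 < a + j%:R + 1 by move: (aj) => ?; lra.
  have [_] := has_integralZ mI ((2 - x) ^+ i) (has_integral_powR aj x0).
  rewrite mulrA exprn_powR// mulrC => <-; apply: eq_integral => y.
  rewrite inE/= in_itv/= => /andP[y0 _].
  by rewrite bieval_mon/= -mulrA exprn_powR.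
rewrite integral_itv_obnd_cbnd; last first.
  apply/measurable_EFinP/measurable_funTS; apply: measurable_funM => //.
  apply: (measurableT_comp (measurable_powR _)).
  by apply: measurable_funB.
have mI : measurable (`[1%R, 2%R]%classic : set (measurableTypeR R)).
  exact: measurable_itv.
have := integral_powR_subl 2 aij ler01.
rewrite (_ : 2 - 1 = 1 :> R); last by ring.
move=> I2.
have H : has_integral mu `[1, 2] (fun u => (2 - u) `^ (a + j%:R + 1 + i%:R))
    (1 `^ (a + j%:R + 1 + i%:R + 1) / (a + j%:R + 1 + i%:R + 1)).
  apply: ge0_has_integral => //.
    apply: measurable_funTS; apply: (measurableT_comp (measurable_powR _)).
    by apply: measurable_funB.
  by move=> x _; exact: powR_ge0.
have [_ ->] := has_integralZ mI (a + j%:R + 1)^-1 H.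
rewrite powR1 div1r /tri_moment -invfM; congr (_^-1%:E).
by ring.
Qed.

End Tonelli.

(** * The norms as moments *)

Section Norms.
Variable R : realType.
Local Notation mu := (@lebesgue_measure R).
Local Notation plane := (measurableTypeR R * measurableTypeR R)%type.
Local Notation V := (bipoly R).
Variable a : R.
Hypothesis ha : -1 < a.

Lemma rect_functional_ge0 (u : V) : 0 <= rect_functional a (u * u).
Proof.
have [_ uE] := has_integral_unit_square ha (u * u).
rewrite -lee_fin -uE; apply: integral_ge0 => z [/=].
rewrite !in_itv/= => _ /andP[y0 y1].
rewrite lee_fin bievalM; apply: mulr_ge0; first by rewrite -expr2 sqr_ge0.
by rewrite mulr_ge0 ?powR_ge0 ?subr_ge0.
Qed.

Lemma tri_functional_ge0 (u : V) : 0 <= tri_functional a (u * u).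
Proof.
have [_ uE] := has_integral_right_part ha (u * u).
rewrite -lee_fin -uE; apply: integral_ge0 => z _.
by rewrite lee_fin bievalM mulr_ge0 ?powR_ge0// -expr2 sqr_ge0.
Qed.

Lemma trapezoidE : @trapezoid R = (@unit_square R) `|` (@right_part R).
Proof.
apply/seteqP; split=> z;
  rewrite /trapezoid /unit_square /right_part /= !in_itv/=.
  move=> [/andP[y0 y1] /andP[x0 x1]]; have [x1'|x1'] := leP z.1 1.
    by left; rewrite x0 y0 y1.
  by right; rewrite y0/=; split; lra.
move=> [[/andP[x0 x1] /andP[y0 y1]]|[/andP[x1 x2] /andP[y0 y1]]].
  by rewrite y0 y1 x0/=; split => //; lra.
by rewrite y0/=; split; [|apply/andP; split]; lra.
Qed.

Lemma disjoint_parts : [disjoint (@unit_square R) & (@right_part R)].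
Proof.
rewrite disj_set2E; apply/eqP/seteqP; split=> z //= [[+ _] [/andP[x1 _] _]].
by rewrite /= in_itv/= => /andP[_]; rewrite leNgt x1.
Qed.

(** On the right only measurability and sign are asked of the density, since the [Phi_y] part is not
    known to be integrable by itself. *)
Lemma sqnormL2_trapezoid (w u v1 v2 : R * R -> R) (c1 : R) :
  (forall z, unit_square z -> `|u z| ^+ 2 * w z = v1 z) ->
  (forall z, right_part z -> `|u z| ^+ 2 * w z = v2 z) ->
  (forall z, unit_square z -> 0 <= v1 z) ->
  (forall z, right_part z -> 0 <= v2 z) ->
  has_integral (mu \x mu)%E (@unit_square R) v1 c1 ->
  measurable_fun (@right_part R : set plane) v2 ->
  sqnormL2 (@trapezoid R) w u =
  (c1%:E + \int[mu \x mu]_(z in (@right_part R)) (v2 z)%:E)%E.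
Proof.
move=> uv1 uv2 v10 v20 [Iv1 <-] mv2.
have mS : measurable (@unit_square R : set plane) by exact: measurable_unit_square.
have mT : measurable (@right_part R : set plane) by exact: measurable_right_part.
rewrite /sqnormL2 trapezoidE ge0_integral_setU//.
- congr (_ + _)%E; apply: eq_integral => z; rewrite inE => Hz.
    by rewrite uv1.
  by rewrite uv2.
- apply/measurable_EFinP/measurable_funU => //; split.
    apply: (eq_measurable_fun v1) => [z|]; first by rewrite inE => /uv1.
    by apply/measurable_EFinP; exact: measurable_int Iv1.
  by apply: (eq_measurable_fun v2) => [z|//]; rewrite inE => /uv2.
- by move=> z [Hz|Hz]; rewrite lee_fin; [rewrite uv1 ?v10|rewrite uv2 ?v20].
- exact: disjoint_parts.
Qed.

(** The triangle exceeds [right_part] only on the line x = 1, where [Hop f] vanishes. *)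
Lemma sqnormL2_triangle (w u v : R * R -> R) :
  (forall z, z.1 = 1 -> u z = 0) ->
  (forall z, right_part z -> `|u z| ^+ 2 * w z = v z) ->
  sqnormL2 (@triangle R) w u =
  (\int[mu \x mu]_(z in (@right_part R)) (v z)%:E)%E.
Proof.
move=> u1 uv; rewrite /sqnormL2 integral_mkcond [RHS]integral_mkcond.
apply: eq_integral => z _; rewrite /patch.
have [zr|zr] := boolP (z \in (@right_part R)).
  rewrite mem_set ?uv//; first by rewrite inE in zr.
  move: zr; rewrite inE => -[/andP[x1 x2] /andP[y0 y1]].
  by rewrite /triangle/= y0/=; split; [|apply/andP; split]; lra.
case: ifPn => // zt; rewrite u1 ?normr0 ?expr0n ?mul0r//.
move: zt zr; rewrite inE notin_setE => -[/andP[y0 y1] /andP[x1 x2]] zr.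
apply/eqP; rewrite eq_le x1 andbT leNgt; apply/negP => x1'; apply: zr.
by rewrite /right_part/= y0/=; split; [apply/andP; split|]; lra.
Qed.

Variable f : V.
Let fx := bieval (dx f).
Let fy := bieval (dy f).

Lemma weightY_square (z : R * R) :
  unit_square z -> weightY a z = z.2 `^ a * (1 - z.2).
Proof.
by move=> [/=]; rewrite !in_itv/= => /andP[_ x1] _; rewrite /weightY x1.
Qed.

Lemma weightY_right (z : R * R) : right_part z -> weightY a z = z.2 `^ a.
Proof. by move=> [/andP[x1 _] _]; rewrite /weightY leNgt x1. Qed.

(** Since (2 - x - y) - (1 - y) (2 - x) = y (1 - x), the sign of 1 - x decides which root is the
    minimum. *)
Lemma Phi_y_square (z : R * R) : unit_square z -> Phi_y z ^+ 2 = z.2 * (1 - z.2).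
Proof.
move=> [/=]; rewrite !in_itv/= => /andP[x0 x1] /andP[y0 y1].
rewrite /Phi_y; case: z x0 x1 y0 y1 => x y /= x0 x1 y0 y1.
have s0 : 0 < 2 - x by lra.
rewrite min_l; first by rewrite sqr_sqrtr// mulr_ge0// subr_ge0.
rewrite ler_pdivlMr ?sqrtr_gt0// -!sqrtrM ?mulr_ge0 ?subr_ge0//.
by apply: ler_wsqrtr; rewrite -mulrA; apply: ler_wpM2l => //;
  rewrite -subr_ge0 (_ : _ - _ = y * (1 - x)) ?mulr_ge0 ?subr_ge0//; ring.
Qed.

Lemma Phi_y_right (z : R * R) : right_part z ->
  Phi_y z ^+ 2 = z.2 * (2 - z.1 - z.2) / (2 - z.1).
Proof.
move=> [/andP[x1 x2] /andP[y0 y1]].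
rewrite /Phi_y; case: z x1 x2 y0 y1 => x y /= x1 x2 y0 y1.
have : 0 <= 2 - x by lra.
rewrite le_eqVlt => /predU1P[s0|s0].
  have -> : y = 0 by lra.
  by rewrite !mul0r sqrtr0 !mul0r minxx expr0n.
rewrite min_r.
  by rewrite exprMn exprVn exprMn !sqr_sqrtr//; lra.
rewrite ler_pdivrMr ?sqrtr_gt0// -!sqrtrM//; last by apply: mulr_ge0 => //; lra.
by apply: ler_wsqrtr; rewrite -mulrA; apply: ler_wpM2l => //;
  rewrite -subr_ge0 (_ : _ - _ = y * (x - 1)) ?mulr_ge0 ?subr_ge0 ?(ltW x1)//; ring.
Qed.

Lemma Hop_right (z : R * R) : right_part z ->
  Hop f z ^+ 2 = (z.1 - 1) / (2 - z.1) * ((z.1 - 2) * fx z + z.2 * fy z) ^+ 2.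
Proof.
move=> [/andP[x1 x2] _].
by rewrite /Hop exprMn exprMn exprVn !sqr_sqrtr//; lra.
Qed.

Lemma bieval_rect_form z :
  bieval (rect_form f f) z = z.2 * (1 - z.2) * fy z ^+ 2.
Proof.
rewrite /rect_form !bievalM -/(fy z).
have -> : bieval (vary R) z = z.2 by rewrite varyE bieval_mon mul1r.
have -> : bieval (1 - vary R) z = 1 - z.2.
  rewrite -scaleN1r bievalD bievalZ mulN1r varyE bieval_mon mul1r.
  by rewrite -mon00 bieval_mon mul1r.
by ring.
Qed.

(** The minus sign of the cross term is that of [dx_flip]. *)
Lemma bieval_tri_form z : bieval (tri_form (flip f) (flip f)) (2 - z.1, z.2) =
  (z.1 - 1) * ((2 - z.1) * fx z ^+ 2 - 2 * z.2 * fx z * fy z)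
  + z.2 * (1 - z.2) * fy z ^+ 2.
Proof.
have vxE (t : R * R) : bieval (varx R) t = t.1 by rewrite varxE bieval_mon mulr1.
have vyE (t : R * R) : bieval (vary R) t = t.2 by rewrite varyE bieval_mon mul1r.
have E1 (t : R * R) : bieval (1 : V) t = 1 by rewrite -mon00 bieval_mon mul1r.
have EN (u : V) (t : R * R) : bieval (- u) t = - bieval u t.
  by rewrite -scaleN1r bievalZ mulN1r.
have Efl (u : V) : bieval (flip u) (2 - z.1, z.2) = bieval u z.
  by rewrite bieval_flip/= opprB addrC subrK -surjective_pairing.
rewrite /tri_form dx_flip dy_flip.
rewrite !(bievalD, bievalM, EN, E1, Efl, vxE, vyE)/= -/(fx z) -/(fy z).
by ring.
Qed.

(* The inverse is written as a power, whose measurability is in the library. *)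
Definition Hop_density (z : R * R) : R :=
  (z.1 - 1) * (2 - z.1) `^ (-1) * ((z.1 - 2) * fx z + z.2 * fy z) ^+ 2 * z.2 `^ a.

Lemma measurable_Hop_density : measurable_fun [set: plane] Hop_density.
Proof.
have mx : measurable_fun [set: plane] (fun z => z.1 : R) by exact: measurable_fst.
have my : measurable_fun [set: plane] (fun z => z.2 : R) by exact: measurable_snd.
apply: measurable_funM; last exact: measurable_snd_powR.
apply: measurable_funM.
  apply: measurable_funM; first exact: measurable_funB.
  by apply: (measurableT_comp (measurable_powR _)); exact: measurable_funB.
apply: measurable_funX; apply: measurable_funD.
  by apply: measurable_funM; [exact: measurable_funB|exact: measurable_bieval].
by apply: measurable_funM => //; exact: measurable_bieval.
Qed.

Let u (z : R * R) : R := Phi_y z * fy z.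
Let tri_density (z : R * R) : R :=
  bieval (tri_form (flip f) (flip f)) (2 - z.1, z.2) * z.2 `^ a.

Lemma Hop_densityE (z : R * R) :
  right_part z -> `|Hop f z| ^+ 2 * weightY a z = Hop_density z.
Proof.
move=> zr; rewrite real_normK ?num_real// Hop_right// weightY_right// /Hop_density.
by move: zr => [/andP[_ x2] _]; rewrite powR_inv1// subr_ge0.
Qed.

(** With s = 2 - x, the coefficient of y^2 f_y^2 is (1 - s) / s in the square of [Hop f] and -1 / s
    in the [Phi_y] term; they add up to -1. The difference form also gives measurability. *)
Lemma Phi_y_densityE (z : R * R) : right_part z ->
  `|u z| ^+ 2 * weightY a z = tri_density z - Hop_density z.
Proof.
move=> zr; rewrite -(Hop_densityE zr) !real_normK ?num_real// weightY_right//.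
rewrite /tri_density Hop_right// /u exprMn Phi_y_right// bieval_tri_form.
rewrite -mulrBl; congr (_ * _).
move: zr => [/andP[x1 x2] /andP[y0 y1]].
have : 0 <= 2 - z.1 by rewrite subr_ge0.
(* At the vertex (2, 0) the inverse of 0 is 0 and y = 0, so the identity holds there too. *)
rewrite le_eqVlt => /predU1P[s0|s0].
  have z1 : z.1 = 2 by lra.
  have -> : z.2 = 0 by lra.
  by rewrite z1 subrr invr0; ring.
by field; rewrite gt_eqF.
Qed.

Lemma sqnormL2_Hop_Phi_yE :
  (sqnormL2 (@triangle R) (weightY a) (Hop f) +
   sqnormL2 (@trapezoid R) (weightY a) (fun z => (Phi_y z * bieval (dy f) z)%R))%E =
  (rect_functional a (rect_form f f) +
   tri_functional a (tri_form (flip f) (flip f)))%:E.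
Proof.
have mT : measurable (@right_part R : set plane) by exact: measurable_right_part.
have mH : measurable_fun (@right_part R : set plane) Hop_density.
  by apply: measurable_funTS; exact: measurable_Hop_density.
have mt : measurable_fun (@right_part R : set plane) tri_density.
  apply: measurable_funTS; apply: measurable_funM; last exact: measurable_snd_powR.
  under eq_fun do rewrite -bieval_flip.
  exact: measurable_bieval.
rewrite (@sqnormL2_triangle _ _ Hop_density); last 2 first.
- by move=> z z1; rewrite /Hop z1 subrr sqrtr0 !mul0r.
- exact: Hop_densityE.
have w0 (z : R * R) : right_part z -> 0 <= weightY a z.
  by move=> zr; rewrite weightY_right// powR_ge0.
have H0 (z : R * R) : right_part z -> 0 <= Hop_density z.
  by move=> zr; rewrite -Hop_densityE// mulr_ge0 ?w0// exprn_ge0.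
have P0 (z : R * R) : right_part z -> 0 <= tri_density z - Hop_density z.
  by move=> zr; rewrite -Phi_y_densityE// mulr_ge0 ?w0// exprn_ge0.
have mP : measurable_fun (@right_part R : set plane)
    (fun z => tri_density z - Hop_density z).
  exact: measurable_funB.
rewrite (@sqnormL2_trapezoid _ u _ (fun z => tri_density z - Hop_density z)
  _ _ Phi_y_densityE _ P0 (has_integral_unit_square ha (rect_form f f)) mP).
- rewrite addeCA EFinD; congr (_ + _)%E.
  have [_ <-] := has_integral_right_part ha (tri_form (flip f) (flip f)).
  (* Nonnegativity lets the integrals add up before either is known to be finite. *)
  rewrite -ge0_integralD//.
  + apply: eq_integral => z _; rewrite -EFinD; congr EFin.
    by rewrite addrC subrK.
  + exact/measurable_EFinP.
  + exact/measurable_EFinP.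
- move=> z zs; rewrite real_normK ?num_real// weightY_square// bieval_rect_form.
  by rewrite /u exprMn Phi_y_square.
- move=> z [/=]; rewrite !in_itv/= => _ /andP[y0 y1].
  have y10 : 0 <= z.2 * (1 - z.2) by rewrite mulr_ge0 ?subr_ge0.
  have w10 : 0 <= z.2 `^ a * (1 - z.2) by rewrite mulr_ge0 ?subr_ge0 ?powR_ge0.
  rewrite bieval_rect_form; apply: mulr_ge0 => //.
  by apply: mulr_ge0 => //; exact: sqr_ge0.
Qed.

Lemma sqnormL2_trapezoid_bieval :
  sqnormL2 (@trapezoid R) (weightY a) (bieval f) =
  (rect_functional a (f * f) + tri_functional a (flip f * flip f))%:E.
Proof.
pose v (z : R * R) := bieval (flip f * flip f) (2 - z.1, z.2) * z.2 `^ a.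
have vE z : v z = bieval f z ^+ 2 * z.2 `^ a.
  by rewrite /v bievalM !bieval_flip/= opprB addrC subrK -surjective_pairing -expr2.
have [_ vI] := has_integral_right_part ha (flip f * flip f).
rewrite EFinD -vI.
apply: sqnormL2_trapezoid (has_integral_unit_square ha (f * f)) _.
- by move=> z zs; rewrite real_normK ?num_real// weightY_square// bievalM -expr2.
- by move=> z zr; rewrite real_normK ?num_real// weightY_right// -/(v z) vE.
- move=> z [/=]; rewrite !in_itv/= => _ /andP[y0 y1].
  have w10 : 0 <= z.2 `^ a * (1 - z.2) by rewrite mulr_ge0 ?subr_ge0 ?powR_ge0.
  by rewrite bievalM -expr2; apply: mulr_ge0 => //; exact: sqr_ge0.
- by move=> z zr; rewrite -/(v z) vE; apply: mulr_ge0; rewrite ?sqr_ge0 ?powR_ge0.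
- apply: measurable_funTS; apply: measurable_funM; last exact: measurable_snd_powR.
  under eq_fun do rewrite -bieval_flip.
  exact: measurable_bieval.
Qed.

End Norms.

(** * Orthogonality on [-1, 1] *)

Section JacobiIntegral.
Variable R : realType.
Local Notation mu := (@lebesgue_measure R).
Variable a : R.
Hypothesis ha : -1 < a.

Lemma bieval_in_y (p : {poly R}) z : bieval (in_y p) z = p.[z.2].
Proof.
rewrite horner_coef in_yE.
have H (r : seq 'I_(size p)) : bieval (\sum_(k <- r) p`_k *: monomial R 0 k) z =
    \sum_(k <- r) p`_k * z.2 ^+ k.
  elim: r => [|k r IH]; first by rewrite !big_nil /bieval mpoly.meval0.
  by rewrite !big_cons bievalD bievalZ IH bieval_mon mul1r.
exact: H.
Qed.

Lemma has_integral_powR_subl (b : R) : -1 < b ->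
  has_integral mu `[-1, 1] (fun u => (1 - u) `^ b) (2 `^ (b + 1) / (b + 1)).
Proof.
move=> b1; apply: ge0_has_integral.
- apply: measurable_funTS; apply: (measurableT_comp (measurable_powR _)).
  by apply: measurable_funB.
- by move=> x _; exact: powR_ge0.
- have := @integral_powR_subl R 1 2 b b1 (ler0n _ 2).
  by rewrite (_ : 1 - 2 = -1)//; ring.
Qed.

(** With t = (1 - u) / 2, the measure (1 - u)^a (1 + u) du is 2^(a+2) t^a (1 - t) dt up to
    orientation; this is verified on powers of t. *)
Lemma has_integral_jacobi (p : {poly R}) :
  has_integral mu `[-1, 1] (fun u => p.[(1 - u) / 2] * ((1 - u) `^ a * (1 + u)))
    (2 `^ (a + 2) * rect_functional a (in_y p)).
Proof.
have mI : measurable (`[-1, 1]%classic : set (measurableTypeR R)).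
  exact: measurable_itv.
(* At [x = 0] only the monomials with [i = 0] survive. *)
pose phi (i j : nat) : R^o := (i == 0)%:R * (2 `^ (a + 2) * rect_moment a 0 j).
have -> : 2 `^ (a + 2) * rect_functional a (in_y p) = linext phi (in_y p).
  rewrite /rect_functional/= in_yE.
  elim: (index_enum _) => [|k r IH]; first by rewrite big_nil !linear0 mulr0.
  rewrite big_cons !linextD !linextZ !linext_mon mulrDr IH; congr (_ + _).
  by rewrite /phi mul1r mulrCA.
have key i j : has_integral mu `[-1, 1]
    (fun u => bieval (monomial R i j) (0, (1 - u) / 2) * ((1 - u) `^ a * (1 + u)))
    (phi i j).
  have aj := natr_gtN1 ha j.
  have aj1 := natr_gtN1 ha j.+1.
  (* As 1 + u = 2 - (1 - u), the weight splits into two powers of 1 - u. *)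
  have I1 := has_integralZ mI 2 (has_integral_powR_subl aj).
  have I2 := has_integral_powR_subl aj1.
  have := has_integralZ mI ((i == 0)%:R * 2^-1 ^+ j)
    (has_integral_lin mI (-1) I2 I1).
  set v := (X in has_integral _ _ _ X).
  have -> : v = phi i j.
    rewrite /v /phi -mulrA; congr (_ * _); rewrite /rect_moment add0r mul1r.
    have two0 : 2 != 0 :> R by rewrite pnatr_eq0.
    rewrite -[j.+1%:R]natr1.
    have -> : a + (j%:R + 1) + 1 = a + 2 + j%:R by ring.
    have -> : a + j%:R + 1 = (a + 2 + j%:R) - 1 by ring.
    rewrite [2 `^ (a + 2 + j%:R - 1)]powRB ?two0 ?implybT// powRr1//.
    rewrite [2 `^ (a + 2 + j%:R)]powRD ?two0 ?implybT// powR_mulrn// exprVn.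
    field.
    by rewrite expf_neq0//=; do ?(apply/andP; split) => //; apply: lt0r_neq0;
      move: (aj) => ?; lra.
  apply: eq_has_integral => // u; rewrite /= in_itv/= => /andP[u1 u2].
  have u0 : 0 <= 1 - u by rewrite subr_ge0.
  rewrite bieval_mon/= expr0n -!exprn_powR// exprMn exprVn exprS.
  by ring.
have := has_integral_linext mI key (in_y p).
by apply: eq_has_integral => // u _; rewrite bieval_in_y.
Qed.

(** The affine substitution preserves degrees, so testing against [q] amounts to testing
    [shifted_jacobi] against [shifted q]. *)
Lemma jacobi_is_jacobi n : is_jacobi a 1 n (jacobi a n).
Proof.
split; [exact: size_jacobi|exact: jacobi1|move=> q qn].
pose qs := shifted q.
have qsE u : qs.[(1 - u) / 2] = q.[u].
  rewrite /qs /shifted horner_comp; congr (_.[_]).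
  by rewrite hornerD hornerN hornerC hornerZ hornerX; field.
have size_qs : (size qs <= n)%N.
  rewrite /qs /shifted size_comp_poly2// -opprB size_polyN.
  have -> : (2 *: 'X - 1 : {poly R}) = 2 *: ('X - (2^-1)%:P).
    by rewrite scalerBr -[2^-1%:P]alg_polyC scalerA mulfV ?pnatr_eq0// scale1r.
  by rewrite size_scale ?pnatr_eq0// size_XsubC.
have [_ I] := has_integral_jacobi (shifted_jacobi a n * qs).
rewrite shifted_jacobi_orthogonal// mulr0 in I.
rewrite -[RHS]I; apply: eq_integral => u; rewrite inE/= in_itv/= => /andP[u1 _].
rewrite hornerM qsE horner_jacobi powRr1//.
by rewrite -lerBlDl sub0r.
Qed.

End JacobiIntegral.

Theorem proposition5p4 (R : realType) (a : R) (n : nat)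
    (ha : -1 < a) (hn : (1 <= n)%N) :
  let lhs (f : bipoly R) :=
    (sqnormL2 (@triangle R) (weightY a) (Hop f) +
     sqnormL2 (@trapezoid R) (weightY a)
       (fun z => (Phi_y z * bieval (dy f) z)%R))%E in
  let rhs (f : bipoly R) :=
    ((n%:R * (n%:R + a + 2))%:E *
     sqnormL2 (@trapezoid R) (weightY a) (bieval f))%E in
  (forall f : bipoly R, in_Pi n f -> (lhs f <= rhs f)%E) /\
  (exists2 P : {poly R}, is_jacobi a 1 n P &
     lhs (in_y (shifted P)) = rhs (in_y (shifted P))).
Proof.
move=> lhs rhs.
(* Both sides become real numbers split at x = 1, so the estimates, and likewise the equalities, add
   up. *)
have lhs_rhs f : lhs f = (rect_functional a (rect_form f f) +
      tri_functional a (tri_form (flip f) (flip f)))%:E /\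
    rhs f = (lam a n * rect_functional a (f * f) +
      lam a n * tri_functional a (flip f * flip f))%:E.
  rewrite /lhs /rhs sqnormL2_Hop_Phi_yE// sqnormL2_trapezoid_bieval//.
  by rewrite -EFinM -/(lam a n) mulrDr.
split=> [f fn|].
  have [-> ->] := lhs_rhs f; rewrite lee_fin; apply: lerD.
    by apply: rect_form_le => // u; exact: rect_functional_ge0.
  by apply: tri_form_le => // u; exact: tri_functional_ge0.
exists (jacobi a n); first exact: jacobi_is_jacobi.
rewrite shifted_of_jacobi; have [-> ->] := lhs_rhs (in_y (shifted_jacobi a n)).
by rewrite rect_form_jacobi// tri_form_jacobi.
Qed.
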